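(* Let $\bar\lambda>0$ be as in the context and assume that $|\lambda_1|,|\lambda_2|\le\bar\lambda$ are sufficiently small so that $1-|\lambda_1|\delta>0$, $\gamma_3-|\gamma_4|\delta>0$ and $1-|\lambda_2|\delta>0$. Assume that the time step satisfies $\frac{6C^2\mathcal D_4}{\nu\varrho}\Delta t\le1$. Then the sequence $\mathbf u_h^n$ produced by the fully discrete scheme of the context satisfies, for $1\le n\le N$, $$\|\mathbf u_h^n\|^2_{L^2(\Omega)}+\sum_{i=1}^n\|\mathbf u_h^i-\mathbf u_h^{i-1}\|^2_{L^2(\Omega)}+\frac{\gamma_1}{\alpha E_1}\sum_{i=1}^n\Delta t\;d_2(\mathbf u_h^i)\le\|\mathbf u_h^0\|^2_{L^2(\Omega)}+\frac{E_1}{\gamma_1}\frac{(\mathcal P\mathcal K)^2}2\,\varrho\,C_1\exp(C_2t_n),$$ where $d_2(\mathbf f):=\|\boldsymbol\varepsilon(\mathbf f)\|^2_{L^2(\Omega)}+2|E_2|\gamma_5\gamma_7\|\operatorname{div}\mathbf f\|^2_{L^2(\Omega)}$ and $$C_1:=\|\mathbf v_h^0\|^2_{L^2(\Omega)}+\frac{3C^2\mathcal D_3}{\nu\varrho}\|\mathbf u_h^0\|^2_{L^2(\Omega)},\qquad C_2:=\frac{9C^2\mathcal D_4}{\nu\varrho}.$$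
   Context: **Continuous problem.** $\Omega\subset\mathbb R^d$, $d\in\{2,3\}$, is a bounded connected open Lipschitz polytopal domain, $T>0$. Parameters: $\alpha,\nu,\varrho>0$; $E_1>0$, $E_2<0$, $E_1-d|E_2|>0$; $\lambda_1,\lambda_2\in\mathbb R$. $\boldsymbol\varepsilon(\mathbf w)=\frac12(\nabla\mathbf w+(\nabla\mathbf w)^t)$ and $F(f)=E_1(1+\lambda_1f)-d|E_2|(1+\lambda_2f)=\gamma_3+\gamma_4f$. $V=\{\mathbf w\in H^1_0(\Omega)^d:\operatorname{div}\mathbf w=0\}$; $L^2_0(\Omega)$ is the space of mean-zero functions of $L^2(\Omega)$. Initial data $\mathbf u_0\in H^1_0(\Omega)^d$, $\mathbf v_0\in V$. The continuous problem is to find $\mathbf u$, $\mathbf v$ (divergence free), vanishing on $\partial\Omega$, and $p$ (mean zero), with $\mathbf u(0)=\mathbf u_0$, $\mathbf v(0)=\mathbf v_0$ and, for all $\mathbf z,\mathbf w\in H^1_0(\Omega)^d$ and a.e. $t\in]0,T[$, $$\int_\Omega\frac{\boldsymbol\varepsilon(\mathbf u):\boldsymbol\varepsilon(\mathbf z)}{E_1(1+\lambda_1\operatorname{div}\mathbf u)}+\int_\Omega\frac{|E_2|(1+\lambda_2\operatorname{div}\mathbf u)}{E_1(1+\lambda_1\operatorname{div}\mathbf u)}\frac{\operatorname{div}\mathbf u}{F(\operatorname{div}\mathbf u)}\operatorname{div}\mathbf z+\alpha\langle\partial_t\mathbf u,\mathbf z\rangle=\alpha\int_\Omega\mathbf v\cdot\mathbf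 z,$$ $$\langle\varrho\,\partial_t\mathbf v+\nabla p,\mathbf w\rangle+\nu\int_\Omega\nabla\mathbf v:\nabla\mathbf w+\alpha\int_\Omega\mathbf v\cdot\mathbf w=\alpha\langle\partial_t\mathbf u,\mathbf w\rangle.$$ **Standing assumption.** $\bar\lambda>0$ and $D>0$ are such that for all $|\lambda_1|,|\lambda_2|\le\bar\lambda$ the continuous problem has a solution with $\mathbf v,\mathbf u\in L^\infty(0,T;H^2(\Omega)^d)$, $\partial_t\mathbf v,\partial_t\mathbf u\in L^2(0,T;H^1(\Omega)^d)$, $\partial_{tt}^2\mathbf u\in L^2(0,T;H^{-1}(\Omega)^d)$, $p\in L^\infty(0,T;H^1(\Omega))$ and $\|\operatorname{div}\mathbf u\|_{L^\infty(0,T;L^\infty(\Omega))}\le D$. **Truncation.** A number $\delta\ge D$ is fixed, and $T_\delta f=f$ if $|f|\le\delta$, $T_\delta f=\delta\,\mathrm{sign}(f)$ if $|f|>\delta$. **Constants.** $\gamma_1=\frac1{1+|\lambda_1|\delta}$, $\gamma_2=\frac1{1-|\lambda_1|\delta}$, $\gamma_3=E_1+dE_2$, $\gamma_4=E_1\lambda_1+dE_2\lambda_2$, $\gamma_5=\frac1{\gamma_3+|\gamma_4|\delta}$, $\gamma_6=\frac1{\gamma_3-|\gamma_4|\delta}$, $\gamma_7=1-|\lambda_2|\delta$, $\gamma_8=1+|\lambda_2|\delta$. Under the smallness conditions, for all $\mathbf w\in H^1_0(\Omega)^d$: $\gamma_1\le(1+\lambda_1T_\delta\operatorname{div}\mathbf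 w)^{-1}\le\gamma_2$, $\gamma_5\le F(T_\delta\operatorname{div}\mathbf w)^{-1}\le\gamma_6$, $0<\gamma_7\le1+\lambda_2T_\delta\operatorname{div}\mathbf w\le\gamma_8$. $\mathcal P,\mathcal K>0$ are the Poincaré and Korn constants of $\Omega$: $\|\mathbf w\|_{L^2}\le\mathcal P\|\nabla\mathbf w\|_{L^2}$, $\|\nabla\mathbf w\|_{L^2}\le\mathcal K\|\boldsymbol\varepsilon(\mathbf w)\|_{L^2}$ for $\mathbf w\in H^1_0(\Omega)^d$. Further $$\mathcal D_1=\frac{(\gamma_6\gamma_8)^2}{\gamma_5\gamma_7}|E_2|,\quad\mathcal D_2=1+\frac{\mathcal D_1}2,\quad\mathcal D_3=\frac{(\alpha h)^2}{\Delta t}+\frac\alpha{E_1}\frac{\gamma_2^2}{\gamma_1}\mathcal D_2,\quad\mathcal D_4=(\alpha\mathcal P)^2\Big(1+\frac{E_1\mathcal K^2}{\alpha\gamma_1}\mathcal D_3\Big).$$ **Discretization.** $\boldsymbol U_h,\boldsymbol X_h\subset H^1_0(\Omega)^d$ and $Q_h\subset L^2_0(\Omega)$ are finite element spaces with mesh size $h$; there is $\beta^*>0$ independent of $h$ with $\inf_{q\in Q_h}\sup_{\mathbf w\in\boldsymbol X_h}\frac{\int_\Omega q\operatorname{div}\mathbf w}{\|q\|_{L^2}\|\nabla\mathbf w\|_{L^2}}=\beta^*$. $\boldsymbol V_h=\{\mathbf v_h\in\boldsymbol X_h:\int_\Omega q_h\operatorname{div}\mathbf v_h=0\ \forall q_h\in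 Q_h\}$. $\Pi_h$ denotes interpolation operators $H^1_0(\Omega)^d\to\boldsymbol U_h$, $H^1_0(\Omega)^d\to\boldsymbol X_h$ and $V\to\boldsymbol V_h$ (same symbol), satisfying, with $C>0$ independent of $h$, $\|\nabla\Pi_h\mathbf w\|_{L^2}\le C\|\nabla\mathbf w\|_{L^2}$ and $\|\mathbf w-\Pi_h\mathbf w\|_{L^2}\le Ch\|\nabla\mathbf w\|_{L^2}$; this is the constant $C$ of the claim. **Fully discrete scheme.** $N>1$, $\Delta t=T/N$, $t_n=n\Delta t$; $\mathbf u_h^0=\Pi_h\mathbf u_0\in\boldsymbol U_h$, $\mathbf v_h^0=\Pi_h\mathbf v_0\in\boldsymbol V_h$. For $1\le n\le N$, given $\mathbf u_h^{n-1}\in\boldsymbol U_h$, $\mathbf v_h^{n-1}\in\boldsymbol V_h$, find $\mathbf u_h^n\in\boldsymbol U_h$, $\mathbf v_h^n\in\boldsymbol V_h$, $p_h^n\in Q_h$ such that for all $\mathbf z_h\in\boldsymbol U_h$, $\mathbf w_h\in\boldsymbol X_h$, $$\frac{\alpha}{\Delta t}\int_\Omega(\mathbf u_h^n-\mathbf u_h^{n-1})\cdot\mathbf z_h+\frac1{E_1}\int_\Omega\frac{\boldsymbol\varepsilon(\mathbf u_h^n):\boldsymbol\varepsilon(\mathbf z_h)}{1+\lambda_1T_\delta\operatorname{div}\mathbf u_h^{n-1}}+\frac{|E_2|}{E_1}\int_\Omega\frac{1+\lambda_2T_\delta\operatorname{div}\mathbf u_h^{n-1}}{1+\lambda_1T_\delta\operatorname{div}\mathbf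 u_h^{n-1}}\frac{(\operatorname{div}\mathbf u_h^n)(\operatorname{div}\mathbf z_h)}{F(T_\delta\operatorname{div}\mathbf u_h^{n-1})}=\alpha\int_\Omega\mathbf v_h^n\cdot\mathbf z_h,$$ $$\frac{\varrho}{\Delta t}\int_\Omega(\mathbf v_h^n-\mathbf v_h^{n-1})\cdot\mathbf w_h-\int_\Omega p_h^n\operatorname{div}\mathbf w_h+\nu\int_\Omega\nabla\mathbf v_h^n:\nabla\mathbf w_h+\alpha\int_\Omega\mathbf v_h^n\cdot\mathbf w_h=\frac{\alpha}{\Delta t}\int_\Omega(\mathbf u_h^n-\mathbf u_h^{n-1})\cdot\mathbf w_h.$$ *)

(* Defs.v *)
From HB Require Import structures.
From mathcomp Require Import all_boot all_order all_algebra.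
From mathcomp Require Import all_classical all_reals all_analysis.

Set Implicit Arguments.
Unset Strict Implicit.
Unset Printing Implicit Defensive.
Import Order.TTheory GRing.Theory Num.Theory.
Import numFieldNormedType.Exports.
Local Open Scope classical_set_scope.
Local Open Scope ring_scope.

(* sigma-algebra generated by the coordinates (the product Borel sigma-algebra) *)
Section measurable_rV.
Context (R : realType) (n : nat).

Definition rV_coord (i : 'I_n) (x : 'rV[R]_n) : R := x ord0 i.

Let rV_set0 : g_sigma_preimage rV_coord set0.
Proof. exact: sigma_algebra0. Qed.

Let rV_setC A : g_sigma_preimage rV_coord A -> g_sigma_preimage rV_coord (~` A).
Proof. exact: sigma_algebraC. Qed.

Let rV_bigcup (F : (set 'rV[R]_n)^nat) :
  (forall i, g_sigma_preimage rV_coord (F i)) ->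
  g_sigma_preimage rV_coord (\bigcup_i (F i)).
Proof. exact: sigma_algebra_bigcup. Qed.

HB.instance Definition _ := @isMeasurable.Build default_measure_display
  'rV[R]_n (g_sigma_preimage rV_coord) rV_set0 rV_setC rV_bigcup.

End measurable_rV.

Lemma measurable_rV_coord (R : realType) n (i : 'I_n) :
  measurable_fun setT (@rV_coord R n i).
Proof.
move=> _ Y mY; rewrite setTI; apply: sub_sigma_algebra => /=.
rewrite -bigcup_seq/=; exists i => /=; first by rewrite mem_index_enum.
by exists Y => //; rewrite setTI.
Qed.

Lemma measurable_fun_rVP (R : realType) d (T : measurableType d) n
    (f : T -> 'rV[R]_n) :
  (forall i, measurable_fun setT (@rV_coord R n i \o f)) -> measurable_fun setT f.
Proof.
move=> mf _ A; rewrite setTI /measurable/= => mA.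
suff : [set A | measurable (f @^-1` A)] A by [].
apply: mA; split=> /=.
  split => /=.
  - by rewrite preimage_set0.
  - by move=> B mB; rewrite setTD preimage_setC; exact: measurableC.
  - by move=> F mF; rewrite preimage_bigcup; exact: bigcup_measurable.
move=> B; rewrite -bigcup_seq => -[i _ [C mC <-]] /=.
have := mf i measurableT _ mC; rewrite !setTI comp_preimage //.
Qed.

Section sigma_finite_pushforward.
Context d d' (T : measurableType d) (T' : measurableType d') (R : realType).
Context (m : {measure set T -> \bar R}) (f : T -> T').
Hypotheses (mf : measurable_fun setT f) (sf : sigma_finite setT (pushforward m f)).

Let pm : set T' -> \bar R := pushforward m f.

Let pm0 : pm set0 = 0%E.
Proof. by rewrite /pm /pushforward preimage_set0 measure0. Qed.

Let pm_ge0 A : (0 <= pm A)%E.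
Proof. exact: measure_ge0. Qed.

Let pm_sigma_additive : semi_sigma_additive pm.
Proof.
exact: (@measure_semi_sigma_additive _ _ _
  (measure_function_pushforward__canonical__measure_function_Measure m mf)).
Qed.

#[local] HB.instance Definition _ :=
  isMeasure.Build _ _ _ pm pm0 pm_ge0 pm_sigma_additive.
#[local] HB.instance Definition _ := Measure_isSigmaFinite.Build _ _ _ pm sf.

Lemma sigma_finite_pushforward :
  exists m' : {sigma_finite_measure set T' -> \bar R},
    pushforward m f = m' :> (set T' -> \bar R).
Proof. by exists pm. Qed.

End sigma_finite_pushforward.

Lemma sigma_finite_product_measure d1 d2 (T1 : measurableType d1)
    (T2 : measurableType d2) (R : realType)
    (m1 : {sigma_finite_measure set T1 -> \bar R})
    (m2 : {sigma_finite_measure set T2 -> \bar R}) :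
  sigma_finite setT (m1 \x m2)%E.
Proof.
have /sigma_finiteP[F [TF ndF Foo]] := sigma_finiteT m1.
have /sigma_finiteP[G [TG ndG Goo]] := sigma_finiteT m2.
exists (fun n => F n `*` G n).
  rewrite -setXTT TF TG predeqE => -[x y]; split.
    move=> [/= [n _ Fnx] [k _ Gky]]; exists (maxn n k) => //; split.
    - by move: x Fnx; exact/subsetPset/ndF/leq_maxl.
    - by move: y Gky; exact/subsetPset/ndG/leq_maxr.
  by move=> [n _ []/= ? ?]; split; exists n.
move=> k; have [? ?] := Foo k; have [? ?] := Goo k.
split; first exact: measurableX.
by rewrite product_measure1E// lte_mul_pinfty// ge0_fin_numE.
Qed.

Section lebesgue_rV.
Context (R : realType).

Definition rV_cons n (p : R * 'rV[R]_n) : 'rV[R]_n.+1 :=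
  row_mx (p.1%:M : 'rV_1) p.2.

(* Lebesgue measure on R^n, by slicing along the first coordinate. *)
Fixpoint lebesgue_rV (n : nat) : set 'rV[R]_n -> \bar R :=
  match n with
  | 0 => fun A => \d_(0 : 'rV[R]_0) A
  | m.+1 => fun A => (\int[@lebesgue_measure R]_t
                       lebesgue_rV [set x | A (rV_cons (t, x))])%E
  end.

Lemma rV_cons0 n (p : R * 'rV[R]_n) : rV_cons p ord0 ord0 = p.1.
Proof.
rewrite /rV_cons mxE; case: splitP => [j _|j] //=.
by rewrite !ord1 mxE eqxx mulr1n.
Qed.

Lemma rV_consS n (p : R * 'rV[R]_n) (i : 'I_n) :
  rV_cons p ord0 (lift ord0 i) = p.2 ord0 i.
Proof.
rewrite /rV_cons mxE; case: splitP => [j|j].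
  by rewrite ord1.
by move=> /eqP; rewrite eqSS => /eqP/val_inj <-.
Qed.

Lemma measurable_rV_cons n : measurable_fun setT (@rV_cons n).
Proof.
apply: measurable_fun_rVP => i.
have [j ->|->] := unliftP ord0 i.
  rewrite (_ : _ \o _ = @rV_coord R n j \o snd).
    by apply: measurableT_comp => //; exact: measurable_rV_coord.
  by apply/funext => p /=; rewrite /rV_coord rV_consS.
rewrite (_ : _ \o _ = fst) //.
by apply/funext => p /=; rewrite /rV_coord rV_cons0.
Qed.

Lemma rV_consK n (x : 'rV[R]_n.+1) :
  rV_cons (x ord0 ord0, \row_i x ord0 (lift ord0 i)) = x.
Proof.
apply/rowP => i; have [j ->|->] := unliftP ord0 i; last by rewrite rV_cons0.
by rewrite rV_consS mxE.
Qed.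

Lemma measurable_rV_uncons n : measurable_fun setT
  (fun x : 'rV[R]_n.+1 => (x ord0 ord0, \row_i x ord0 (lift ord0 i) : 'rV[R]_n)).
Proof.
apply/measurable_fun_pair; first exact: (@measurable_rV_coord R n.+1 ord0).
apply: measurable_fun_rVP => i.
rewrite (_ : _ \o _ = @rV_coord R n.+1 (lift ord0 i)).
  exact: measurable_rV_coord.
by apply/funext => x /=; rewrite /rV_coord mxE.
Qed.

Lemma lebesgue_rV_spec n : exists m : {sigma_finite_measure set 'rV[R]_n -> \bar R},
  @lebesgue_rV n = m.
Proof.
elim: n => [|n [m mE]]; first by exists (\d_(0 : 'rV[R]_0)).
pose P : {measure set (measurableTypeR R * 'rV[R]_n)%type -> \bar R} :=
  (@lebesgue_measure R \x m)%E.
pose f := @rV_cons n.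
have mf : measurable_fun setT f by exact: measurable_rV_cons.
have PE : @lebesgue_rV n.+1 = pushforward P f.
  apply/funext => A; rewrite /pushforward /P /product_measure1 /=.
  apply: eq_integral => t _; rewrite mE /=; congr (m _).
  by apply/seteqP; split => x /=; rewrite ?in_setE /xsection /= in_setE.
have sP : sigma_finite setT (pushforward P f).
  have [F FT Foo] := sigma_finite_product_measure (@lebesgue_measure R) m.
  pose g (x : 'rV[R]_n.+1) := (x ord0 ord0, \row_i x ord0 (lift ord0 i) : 'rV[R]_n).
  exists (fun k => g @^-1` F k) => [|k].
    by rewrite -preimage_bigcup -FT preimage_setT.
  have [mFk Fkoo] := Foo k; split.
    by rewrite -[X in measurable X]setTI; exact: measurable_rV_uncons.
  rewrite /pushforward -comp_preimage (_ : g \o f = id) //.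
  apply/funext => -[t x] /=; rewrite /g /f rV_cons0; congr (_, _).
  by apply/rowP => i; rewrite mxE rV_consS.
have [m' m'E] := @sigma_finite_pushforward _ _ _ _ _ P f mf sP.
by exists m'; rewrite PE m'E.
Qed.

Let lebesgue_rV0 n : lebesgue_rV (@set0 'rV[R]_n) = 0%E.
Proof. by have [m ->] := lebesgue_rV_spec n; exact: measure0. Qed.

Let lebesgue_rV_ge0 n (A : set 'rV[R]_n) : (0 <= lebesgue_rV A)%E.
Proof. by have [m ->] := lebesgue_rV_spec n; exact: measure_ge0. Qed.

Let lebesgue_rV_sigma_additive n : semi_sigma_additive (@lebesgue_rV n).
Proof.
by have [m ->] := lebesgue_rV_spec n; exact: measure_semi_sigma_additive.
Qed.

HB.instance Definition _ n := isMeasure.Build _ _ _ (@lebesgue_rV n)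
  (lebesgue_rV0 n) (@lebesgue_rV_ge0 n) (@lebesgue_rV_sigma_additive n).

Let lebesgue_rV_sigma_finite n : sigma_finite setT (@lebesgue_rV n).
Proof. by have [m ->] := lebesgue_rV_spec n; exact: sigma_finiteT. Qed.

HB.instance Definition _ n := Measure_isSigmaFinite.Build _ _ _ (@lebesgue_rV n)
  (lebesgue_rV_sigma_finite n).

End lebesgue_rV.

Arguments lebesgue_rV {R n}.

Section geometry.
Context (R : realType) (d : nat).
Implicit Types (x y e : 'rV[R]_d) (K Omega : set 'rV[R]_d).

Definition dot x y : R := \sum_i x ord0 i * y ord0 i.

Definition enorm x : R := Num.sqrt (dot x x).

Definition convex_hull k (a : 'I_k -> 'rV[R]_d) : set 'rV[R]_d :=
  [set x | exists c : 'I_k -> R,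
    [/\ forall i, 0 <= c i, \sum_i c i = 1 & x = \sum_i c i *: a i]].

Definition polytope K : Prop :=
  (exists k (a : 'I_k -> 'rV[R]_d), K = convex_hull a) /\ interior K !=set0.

Definition diameter K : R :=
  sup [set r | exists x y, [/\ K x, K y & r = enorm (x - y)]].

(* A mesh of Omega: finitely many polytopal cells with disjoint interiors
   covering the closure of Omega. *)
Definition mesh Omega m (K : 'I_m -> set 'rV[R]_d) : Prop :=
  [/\ forall i, polytope (K i),
      closure Omega = \bigcup_i K i &
      forall i j, i != j -> interior (K i) `&` interior (K j) = set0].

Definition mesh_size m (K : 'I_m -> set 'rV[R]_d) (h : R) : Prop :=
  (forall i, diameter (K i) <= h) /\ exists i, diameter (K i) = h.

Definition polytopal Omega : Prop :=
  exists m (K : 'I_m -> set 'rV[R]_d), mesh Omega K.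

(* Near each boundary point Omega is the strict epigraph, in some unit
   direction e, of a Lipschitz function g of the variables orthogonal to e. *)
Definition lipschitz_domain Omega : Prop :=
  forall x, (closure Omega `\` interior Omega) x ->
  exists e (g : 'rV[R]_d -> R) (r : R),
    [/\ enorm e = 1, 0 < r, [lipschitz g y | y in setT],
        forall y t, g (y + t *: e) = g y &
        forall y, ball x r y -> (Omega y <-> g y < dot y e)].

End geometry.

Section sobolev.
Context (R : realType) (d : nat) (Omega : set 'rV[R]_d).
Local Notation point := 'rV[R]_d.
Local Notation SF := ('rV[R]_d -> R).
Local Notation VF := ('rV[R]_d -> 'rV[R]_d).
Local Notation MF := ('rV[R]_d -> 'M[R]_d).
Local Notation mu := (@lebesgue_rV R d).

Definition partial (i : 'I_d) (f : SF) : SF :=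
  fun x => 'D_(delta_mx ord0 i : point) f x.

Fixpoint Ck (k : nat) (f : SF) : Prop :=
  continuous f /\
  match k with
  | 0 => True
  | k'.+1 => forall i : 'I_d,
      (forall x, derivable f x (delta_mx ord0 i : point)) /\ Ck k' (partial i f)
  end.

Definition smooth (f : SF) : Prop := forall k, Ck k f.

Definition test_function (phi : SF) : Prop :=
  [/\ smooth phi, compact (closure [set x | phi x != 0]) &
      closure [set x | phi x != 0] `<=` Omega].

Definition loc_integrable (f : SF) : Prop :=
  forall K, compact K -> K `<=` Omega -> mu.-integrable K (EFin \o f).

Definition is_weak_partial (i : 'I_d) (f g : SF) : Prop :=
  [/\ loc_integrable f, loc_integrable g &
      forall phi, test_function phi ->
        \int[mu]_(x in Omega) (f x * partial i phi x) =
        - \int[mu]_(x in Omega) (g x * phi x)].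

(* The weak derivative, unique up to a null set; 0 if there is none. *)
Definition weak_partial (i : 'I_d) (f : SF) : SF :=
  xget (fun=> 0) [set g | is_weak_partial i f g].

(* Functions are not identified almost everywhere: elements of the spaces below
   are Borel representatives. *)
Definition L2 : set SF := [set f : SF | measurable_fun Omega f /\
  mu.-integrable Omega (EFin \o (fun x => f x ^+ 2))].

Definition H1 : set SF := [set f | L2 f /\ forall i,
  is_weak_partial i f (weak_partial i f) /\ L2 (weak_partial i f)].

Definition H2 : set SF := [set f | H1 f /\ forall i, H1 (weak_partial i f)].

Definition L2norm (f : SF) : R :=
  Num.sqrt (\int[mu]_(x in Omega) (f x ^+ 2)).

Definition H1norm (f : SF) : R :=
  Num.sqrt (L2norm f ^+ 2 + \sum_i L2norm (weak_partial i f) ^+ 2).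

Definition H2norm (f : SF) : R :=
  Num.sqrt (L2norm f ^+ 2 + \sum_i H1norm (weak_partial i f) ^+ 2).

(* Closure of the test functions in H1; for a test function the classical
   derivatives are used. *)
Definition H10 : set SF := [set f | H1 f /\ forall eps : R, 0 < eps ->
  exists2 phi, test_function phi &
    L2norm (f - phi) ^+ 2 +
      \sum_i L2norm (weak_partial i f - partial i phi) ^+ 2 < eps].

Definition L20 : set SF :=
  [set q | L2 q /\ \int[mu]_(x in Omega) q x = 0].

Definition component (w : VF) (i : 'I_d) : SF := fun x => w x ord0 i.

Definition vectorial (X : set SF) : set VF :=
  [set w | forall i, X (component w i)].

Definition vectorial_norm (N : SF -> R) (w : VF) : R :=
  Num.sqrt (\sum_i N (component w i) ^+ 2).

Definition grad (w : VF) : MF :=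
  fun x => \matrix_(i, j) weak_partial j (component w i) x.

Definition div (w : VF) : SF := fun x => \tr (grad w x).

Definition strain (w : VF) : MF :=
  fun x => 2^-1 *: (grad w x + (grad w x)^T).

Definition frob (A B : 'M[R]_d) : R := \sum_i \sum_j A i j * B i j.

Definition inner (u w : VF) : R := \int[mu]_(x in Omega) dot (u x) (w x).

Definition vL2norm (w : VF) : R := Num.sqrt (inner w w).

Definition mL2norm (A : MF) : R :=
  Num.sqrt (\int[mu]_(x in Omega) frob (A x) (A x)).

Definition divfree : set VF := [set w | vectorial H10 w /\
  {ae mu, forall x, Omega x -> div w x = 0}].

(* H^{-1}(Omega)^d and its dual norm *)
Definition Hm1 : set (VF -> R^o) := [set l |
  (forall (a : R) (u w : VF), vectorial H10 u -> vectorial H10 w ->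
     l (a *: u + w) = a * l u + l w) /\
  exists M : R, forall w, vectorial H10 w ->
    `|l w| <= M * vectorial_norm H1norm w].

Definition Hm1norm (l : VF -> R^o) : R :=
  sup [set r | exists w, [/\ vectorial H10 w, vectorial_norm H1norm w <= 1 &
                             r = `|l w|]].

End sobolev.

Section bochner.
Context (R : realType) (T : R) (E : lmodType R) (X : set E) (N : E -> R).
Local Notation leb := (@lebesgue_measure R).

Definition ae_time (P : R -> Prop) : Prop :=
  {ae leb, forall t, `]0, T[%classic t -> P t}.

Definition simple_in (s : R -> E) : Prop :=
  exists m (A : 'I_m -> set R) (e : 'I_m -> E),
    [/\ forall k, measurable (A k), forall k, X (e k) &
        s = fun t => \sum_k (\1_(A k) t : R) *: e k].

Definition strongly_measurable (f : R -> E) : Prop :=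
  ae_time (fun t => X (f t)) /\
  exists s : nat -> R -> E, (forall n, simple_in (s n)) /\
    ae_time (fun t => (fun n => N (s n t - f t)) @ \oo --> (0 : R)).

Definition bochner_Loo (f : R -> E) : Prop :=
  strongly_measurable f /\ exists M, ae_time (fun t => N (f t) <= M).

Definition bochner_L2 (f : R -> E) : Prop :=
  strongly_measurable f /\
  leb.-integrable `]0, T[%classic (EFin \o (fun t => N (f t) ^+ 2)).

End bochner.

Section time_derivative.
Context (R : realType) (T : R).

Definition test_function_time (psi : R -> R) : Prop :=
  [/\ forall n x, derivable (derive1n n psi) x 1,
      compact (closure [set t | psi t != 0]) &
      closure [set t | psi t != 0] `<=` `]0, T[%classic].

Definition is_weak_ddt (a b : R -> R) : Prop :=
  forall psi, test_function_time psi ->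
    \int[@lebesgue_measure R]_(t in `]0, T[%classic) (a t * derive1 psi t) =
    - \int[@lebesgue_measure R]_(t in `]0, T[%classic) (b t * psi t).

End time_derivative.

Section model.
Context (R : realType) (d : nat) (Omega : set 'rV[R]_d).
Local Notation SF := ('rV[R]_d -> R).
Local Notation VF := ('rV[R]_d -> 'rV[R]_d).
Local Notation mu := (@lebesgue_rV R d).
Local Notation vH10 := (vectorial (H10 Omega)).
Local Notation div := (div Omega).
Local Notation eps := (strain Omega).
Local Notation grad := (grad Omega).
Local Notation inner := (inner Omega).

Definition Fcoef (E1 E2 l1 l2 f : R) : R :=
  E1 * (1 + l1 * f) - d%:R * `|E2| * (1 + l2 * f).

Definition trunc (delta f : R) : R :=
  if `|f| <= delta then f else delta * Num.sg f.

(* Weak solution in the regularity class considered.  ut, vt, utt stand for the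
   time derivatives of u, v, ut; u and v are the representatives that are
   continuous from [0, T] to L^2, which gives a meaning to the initial values.
   Since ut, vt are L^2-valued, their pairings with z and w are L^2 products;
   the pairing of the gradient of p with w is minus the integral of p div w. *)
Record continuous_solution (T alpha nu rho E1 E2 l1 l2 : R) (u0 v0 : VF)
    (u v : R -> VF) (p : R -> SF) (ut vt : R -> VF) (utt : R -> VF -> R^o)
    : Prop := ContinuousSolution {
  cs_u_Loo : bochner_Loo T (vectorial (H2 Omega))
    (vectorial_norm (H2norm Omega)) u;
  cs_v_Loo : bochner_Loo T (vectorial (H2 Omega))
    (vectorial_norm (H2norm Omega)) v;
  cs_p_Loo : bochner_Loo T (H1 Omega : set (_ -> R^o)) (H1norm Omega) p;
  cs_ut_L2 : bochner_L2 T (vectorial (H1 Omega))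
    (vectorial_norm (H1norm Omega)) ut;
  cs_vt_L2 : bochner_L2 T (vectorial (H1 Omega))
    (vectorial_norm (H1norm Omega)) vt;
  cs_utt_L2 : bochner_L2 T (Hm1 Omega) (Hm1norm Omega) utt;
  cs_ut : forall z, vH10 z ->
    is_weak_ddt T (fun t => inner (u t) z) (fun t => inner (ut t) z);
  cs_vt : forall z, vH10 z ->
    is_weak_ddt T (fun t => inner (v t) z) (fun t => inner (vt t) z);
  cs_utt : forall z, vH10 z ->
    is_weak_ddt T (fun t => inner (ut t) z) (fun t => utt t z);
  cs_bc_u : ae_time T (fun t => vH10 (u t));
  cs_bc_v : ae_time T (fun t => divfree Omega (v t));
  cs_mean_p : ae_time T (fun t => L20 Omega (p t));
  cs_cont : forall s, `[0, T]%classic s ->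
    [/\ vectorial (L2 Omega) (u s), vectorial (L2 Omega) (v s),
        vL2norm Omega (u t - u s) @[t --> within `[0, T]%classic (nbhs s)]
          --> (0 : R) &
        vL2norm Omega (v t - v s) @[t --> within `[0, T]%classic (nbhs s)]
          --> (0 : R)];
  cs_init_u : {ae mu, forall x, Omega x -> u 0 x = u0 x};
  cs_init_v : {ae mu, forall x, Omega x -> v 0 x = v0 x};
  (* the coefficients and the nonlinear integrals are well defined *)
  cs_denom : ae_time T (fun t => {ae mu, forall x, Omega x ->
    1 + l1 * div (u t) x != 0 /\ Fcoef E1 E2 l1 l2 (div (u t) x) != 0});
  cs_integrable : forall z, vH10 z -> ae_time T (fun t =>
    mu.-integrable Omega (EFin \o (fun x =>
      frob (eps (u t) x) (eps z x) / (E1 * (1 + l1 * div (u t) x)))) /\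
    mu.-integrable Omega (EFin \o (fun x =>
      `|E2| * (1 + l2 * div (u t) x) / (E1 * (1 + l1 * div (u t) x))
      * (div (u t) x / Fcoef E1 E2 l1 l2 (div (u t) x)) * div z x)));
  cs_eq_u : forall z, vH10 z -> ae_time T (fun t =>
    \int[mu]_(x in Omega)
      (frob (eps (u t) x) (eps z x) / (E1 * (1 + l1 * div (u t) x)))
    + \int[mu]_(x in Omega)
      (`|E2| * (1 + l2 * div (u t) x) / (E1 * (1 + l1 * div (u t) x))
       * (div (u t) x / Fcoef E1 E2 l1 l2 (div (u t) x)) * div z x)
    + alpha * inner (ut t) z
    = alpha * inner (v t) z);
  cs_eq_v : forall w, vH10 w -> ae_time T (fun t =>
    rho * inner (vt t) w - \int[mu]_(x in Omega) (p t x * div w x)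
    + nu * \int[mu]_(x in Omega) frob (grad (v t) x) (grad w x)
    + alpha * inner (v t) w
    = alpha * inner (ut t) w)
}.

(* For all small lambda_1, lambda_2 the continuous problem has a solution whose
   divergence is bounded by D, uniformly in lambda_1, lambda_2. *)
Definition solvable (T alpha nu rho E1 E2 : R) (u0 v0 : VF) (lbar D : R)
    : Prop :=
  forall l1 l2 : R, `|l1| <= lbar -> `|l2| <= lbar ->
  exists u v p ut vt utt,
    continuous_solution T alpha nu rho E1 E2 l1 l2 u0 v0 u v p ut vt utt /\
    ae_time T (fun t => {ae mu, forall x, Omega x -> `|div (u t) x| <= D}).

(* A linear space of functions that, on each cell of a mesh of size h, is
   spanned by finitely many shape functions (restrictions of functions in S). *)
Definition fe_space (E : lmodType R) (S : set ('rV[R]_d -> E)) (h : R)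
    (W : set ('rV[R]_d -> E)) : Prop :=
  [/\ W 0, forall (a : R) f g, W f -> W g -> W (a *: f + g) &
    exists m (K : 'I_m -> set 'rV[R]_d),
      [/\ mesh Omega K, mesh_size K h &
        forall i, exists n (b : 'I_n -> 'rV[R]_d -> E), (forall j, S (b j)) /\
          forall w, W w -> exists c : 'I_n -> R,
            {ae mu, forall x, K i x -> w x = \sum_j c j *: b j x}]].

Definition infsup (Xh : set VF) (Qh : set SF) : R :=
  inf [set b | exists q, [/\ Qh q, L2norm Omega q != 0 &
    b = sup [set r | exists w, [/\ Xh w, mL2norm Omega (grad w) != 0 &
      r = (\int[mu]_(x in Omega) (q x * div w x))
          / (L2norm Omega q * mL2norm Omega (grad w))]]]].

Definition discrete_divfree (Xh : set VF) (Qh : set SF) : set VF :=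
  [set w | Xh w /\
    forall q, Qh q -> \int[mu]_(x in Omega) (q x * div w x) = 0].

Definition interpolation (A B : set VF) (C h : R) (Pi : VF -> VF) : Prop :=
  forall w, A w ->
    [/\ B (Pi w),
        mL2norm Omega (grad (Pi w)) <= C * mL2norm Omega (grad w) &
        vL2norm Omega (w - Pi w) <= C * h * mL2norm Omega (grad w)].

(* One time step, from (u', v') to (u, v, p). *)
Definition scheme_step (alpha nu rho E1 E2 l1 l2 delta dt : R)
    (Uh Xh : set VF) (Qh : set SF) (u' v' u v : VF) (p : SF) : Prop :=
  let Tdiv x := trunc delta (div u' x) in
  [/\ Uh u, discrete_divfree Xh Qh v, Qh p,
    (forall z, Uh z ->
      alpha / dt * inner (u - u') z
      + E1^-1 * \int[mu]_(x in Omega)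
          (frob (eps u x) (eps z x) / (1 + l1 * Tdiv x))
      + `|E2| / E1 * \int[mu]_(x in Omega)
          ((1 + l2 * Tdiv x) / (1 + l1 * Tdiv x)
           * (div u x * div z x / Fcoef E1 E2 l1 l2 (Tdiv x)))
      = alpha * inner v z) &
    (forall w, Xh w ->
      rho / dt * inner (v - v') w
      - \int[mu]_(x in Omega) (p x * div w x)
      + nu * \int[mu]_(x in Omega) frob (grad v x) (grad w x)
      + alpha * inner v w
      = alpha / dt * inner (u - u') w)].

End model.

(* Main.v *)
(* Testing the displacement equation with u^n and using Poincare-Korn bounds the
   increase of |u^n|^2, plus the numerical and elastic dissipation, by
   dt (alpha E1 (P K)^2 / gamma1) |v^n|^2.  Testing the velocity equation with v^n
   leaves the coupling term (u^n - u^(n-1), v^n); writing v^n = (v^n - Pi v^n) + Pi v^n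
   and testing the displacement equation with Pi v^n, Young's inequality absorbs
   all gradients of v^n into 2 nu dt |grad v^n|^2, and the elastic terms that
   remain are controlled by the dissipation of the first estimate.  Summation
   and a discrete Gronwall inequality bound alpha dt sum |v^i|^2 by
   (rho / 2) C1 exp(C2 t_n), which is inserted in the first estimate.

   The sharp bound |div w| <= |grad w| of H^1_0 is not needed: in dimension at
   most 3 the pointwise bound |div w|^2 <= d |grad w|^2 suffices, because the
   Young weights need not be equal. *)

Require Import Defs.
From mathcomp Require Import all_boot all_order all_algebra.
From mathcomp Require Import all_classical all_reals all_analysis.
From mathcomp Require Import measurable_realfun ring lra.
Set Implicit Arguments.
Unset Strict Implicit.
Unset Printing Implicit Defensive.
Import Order.TTheory GRing.Theory Num.Theory.
Import numFieldNormedType.Exports.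
Local Open Scope classical_set_scope.
Local Open Scope ring_scope.

(** * Pointwise inequalities for vectors and matrices *)

(** Expand [s^-1 * (s * c * x - y) ^+ 2 >= 0], then use [c ^+ 2 <= g ^+ 2]. The sign of [c] is free,
    so terms with a minus sign are covered, and the bound [g] of the weight falls on [x] only. *)
Lemma young_weighted (R : realType) (s g c x y : R) :
  0 < s -> `|c| <= g -> 2 * (c * (x * y)) <= s * g ^+ 2 * x ^+ 2 + s^-1 * y ^+ 2.
Proof.
move=> s0 cg.
have c2 : c ^+ 2 <= g ^+ 2.
  by rewrite -(real_normK (num_real c)) lerXn2r// nnegrE ?(le_trans _ cg).
have h1 : s * c ^+ 2 * x ^+ 2 <= s * g ^+ 2 * x ^+ 2.
  by rewrite ler_wpM2r ?sqr_ge0// ler_wpM2l// ltW.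
have h2 : 0 <= s^-1 * (s * c * x - y) ^+ 2.
  by rewrite mulr_ge0 ?sqr_ge0// invr_ge0 ltW.
have h3 : s^-1 * (s * c * x - y) ^+ 2 =
    s * c ^+ 2 * x ^+ 2 - 2 * (c * (x * y)) + s^-1 * y ^+ 2.
  by field; rewrite gt_eqF.
lra.
Qed.

Section pointwise.
Context (R : realType) (d : nat).
Implicit Types (x y : 'rV[R]_d) (A B : 'M[R]_d) (c g s : R).

Lemma dot_young s x y : 0 < s -> 2 * dot x y <= s * dot x x + s^-1 * dot y y.
Proof.
move=> s0; rewrite /dot !mulr_sumr -big_split/=; apply: ler_sum => i _.
have := @young_weighted _ s 1 1 (x ord0 i) (y ord0 i) s0.
by rewrite normr1 lexx mul1r expr1n mulr1 -!expr2 => /(_ isT).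
Qed.

Lemma frob_young s g c A B : 0 < s -> `|c| <= g ->
  2 * (c * frob A B) <= s * g ^+ 2 * frob A A + s^-1 * frob B B.
Proof.
move=> s0 cg; rewrite /frob !mulr_sumr -big_split/=; apply: ler_sum => i _.
rewrite !mulr_sumr -big_split/=; apply: ler_sum => j _.
by rewrite -!expr2; exact: young_weighted.
Qed.

Lemma dot_ge0 x : 0 <= dot x x.
Proof. by apply: sumr_ge0 => i _; rewrite -expr2 sqr_ge0. Qed.

Lemma frob_ge0 A : 0 <= frob A A.
Proof. by do 2 apply: sumr_ge0 => ? _; rewrite -expr2 sqr_ge0. Qed.

Lemma dotBl x y z : dot (x - y) z = dot x z - dot y z.
Proof. by rewrite /dot -sumrB; apply: eq_bigr => i _; rewrite !mxE mulrBl. Qed.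

Lemma dotBr x y z : dot z (x - y) = dot z x - dot z y.
Proof. by rewrite /dot -sumrB; apply: eq_bigr => i _; rewrite !mxE mulrBr. Qed.

Lemma dotC x y : dot x y = dot y x.
Proof. by apply: eq_bigr => i _; rewrite mulrC. Qed.

(** Turns a backward difference tested with the new value into a telescoping difference plus the
    squared jump. *)
Lemma dot_polar x y : 2 * dot (x - y) x = dot x x - dot y y + dot (x - y) (x - y).
Proof. rewrite dotBr !dotBl (dotC y x); ring. Qed.

(** Symmetrising the double sum in [i] and [j] reduces the claim to [(A i j - A j i) ^+ 2 >= 0],
    entry by entry. *)
Lemma frob_sym_le A : frob (2^-1 *: (A + A^T)) (2^-1 *: (A + A^T)) <= frob A A.
Proof.
have -> : frob A A = \sum_i \sum_j (2^-1 * (A i j) ^+ 2 + 2^-1 * (A j i) ^+ 2).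
  under eq_bigr do rewrite big_split/= -!mulr_sumr.
  rewrite big_split/= -!mulr_sumr [X in _ + _ * X]exchange_big/= -mulrDr.
  rewrite (_ : frob A A = \sum_i \sum_j A i j ^+ 2); first by lra.
  by apply: eq_bigr => i _; apply: eq_bigr => j _; rewrite expr2.
apply: ler_sum => i _; apply: ler_sum => j _; rewrite !mxE.
have := sqr_ge0 (A i j - A j i); nra.
Qed.

(** Cauchy-Schwarz on the diagonal: each product [A i i * A j j] is at most the mean of the two
    squares, and the double sum of these means is [d] times the sum of squares. *)
Lemma sqr_mxtrace_le A : (\tr A) ^+ 2 <= d%:R * frob A A.
Proof.
have h : \sum_i A i i ^+ 2 <= frob A A.
  apply: ler_sum => i _; rewrite (bigD1 i)//= -expr2 lerDl.
  by apply: sumr_ge0 => j _; rewrite -expr2 sqr_ge0.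
apply: (@le_trans _ _ (d%:R * \sum_i A i i ^+ 2)); last by rewrite ler_wpM2l.
have -> : d%:R * \sum_i A i i ^+ 2 =
    \sum_i \sum_j (2^-1 * A i i ^+ 2 + 2^-1 * A j j ^+ 2).
  under [RHS]eq_bigr do rewrite big_split/= sumr_const card_ord -mulr_sumr.
  rewrite big_split/= sumr_const card_ord.
  under [X in X + _]eq_bigr do rewrite -(mulr_natl _ d).
  by rewrite -!mulr_sumr -(mulr_natl _ d); field.
rewrite /mxtrace expr2 mulr_suml; apply: ler_sum => i _.
rewrite mulr_sumr; apply: ler_sum => j _.
have := sqr_ge0 (A i i - A j j); nra.
Qed.

End pointwise.

(** * Measurability of open sets and of truncations *)

Section measurability.
Context (R : realType) (d : nat).

(** Sup-norm balls are finite intersections of coordinate preimages, hence measurable, and an open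
    set is the union of the countably many balls with rational centre and radius 1/(k+1) that it
    contains. *)
Lemma open_measurable_rV (A : set 'rV[R]_d) : open A -> measurable A.
Proof.
move=> oA.
pose B (i : 'rV[rat]_d * nat) : set 'rV[R]_d :=
  ball (map_mx ratr i.1 : 'rV[R]_d) i.2.+1%:R^-1.
have mB i : measurable (B i).
  have -> : B i = \big[setI/setT]_(j < d) (@rV_coord R d j @^-1`
      ball (ratr (i.1 ord0 j) : R) i.2.+1%:R^-1).
    rewrite -bigcap_seq; apply/seteqP; split.
      move=> y [_ By] j _ /=; have := By ord0 j; by rewrite mxE.
    move=> y By; split => // k j; rewrite ord1 mxE; apply: By.
    by rewrite /= mem_index_enum.
  apply: bigsetI_measurable => j _.
  rewrite -[X in measurable X]setTI; apply: measurable_rV_coord => //.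
  by apply: open_measurable; apply: ball_open; rewrite invr_gt0.
(* Balls not contained in [A] are replaced by the empty set, so that the union runs over a whole
   countable type. *)
have -> : A = \bigcup_(i : 'rV[rat]_d * nat) (if `[< B i `<=` A >] then B i else set0).
  apply/seteqP; split => [x Ax|x [i _]]; last by case: ifPn => // /asboolP; exact.
  have /nbhs_ballP[e /= e0 eA] : nbhs x A by exact: open_nbhs_nbhs.
  (* With radius below [e / 2], every point of a rational ball containing [x] is within [e] of
     [x]. *)
  have [k /= ke] : exists k : nat, k.+1%:R^-1 < e / 2.
    have [k _ /(_ k (leqnn k)) ?] :=
      near_infty_natSinv_lt (PosNum (divr_gt0 e0 (ltr0Sn R 1))).
    by exists k.
  have /choice[q qP] : forall j : 'I_d, exists q : rat,
      ratr q \in `](x 0 j - k.+1%:R^-1), (x 0 j)[.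
    by move=> j; apply: rat_in_itvoo; rewrite ltrBlDr ltrDl invr_gt0.
  have Bx : B (\row_j q j, k) x.
    split => [|i j]; first by rewrite /= invr_gt0.
    rewrite ord1 !mxE /ball/= ler0_norm.
      by have := qP j; rewrite in_itv/= => /andP[+ _]; rewrite opprB !ltrBlDr addrC.
    by have := qP j; rewrite in_itv/= => /andP[_ /ltW]; rewrite subr_le0.
  exists (\row_j q j, k) => //; case: ifPn => // /asboolP; case => y By; apply: eA.
  apply: (@ball_splitr _ _ (map_mx ratr (\row_j q j) : 'rV[R]_d)).
    by apply: le_ball (Bx); exact: ltW.
  by apply: le_ball By; exact: ltW.
apply: countable_bigcupT_measurable => // i; case: ifP => _ //.
Qed.

End measurability.

Section bounded_coefficients.
Context (R : realType) (disp : measure_display) (T : measurableType disp).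
Implicit Types (D : set T) (f g c : T -> R).

Lemma measurable_fun_inv_gt0 D f : (forall x, D x -> 0 < f x) ->
  measurable_fun D f -> measurable_fun D (fun x => (f x)^-1).
Proof.
move=> f0 mf; apply: (eq_measurable_fun (fun x => (f x) `^ (-1))).
  by move=> x; rewrite inE => /f0/ltW; exact: powR_inv1.
exact: (measurableT_comp (measurable_powR _)).
Qed.

(** The clamped form gives both the bound and the measurability of the truncation. *)
Lemma truncE (delta r : R) : 0 <= delta ->
  trunc delta r = Num.max (- delta) (Num.min r delta).
Proof.
move=> d0; rewrite /trunc; case: ifPn => [|].
  by rewrite ler_norml => /andP[h1 h2]; rewrite min_l// max_r.
rewrite -ltNge; case: (ltgtP r 0) => r0.
- rewrite ltr0_norm// => h; rewrite ltr0_sg// mulrN1 min_l ?max_l//; lra.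
- by rewrite gtr0_norm// => h; rewrite gtr0_sg// mulr1 min_r ?max_r//; lra.
- by rewrite r0 normr0 ltNge d0.
Qed.

Lemma norm_trunc_le (delta r : R) : 0 <= delta -> `|trunc delta r| <= delta.
Proof.
move=> d0; rewrite truncE// ler_norml le_max lexx/=.
by rewrite ge_max ge_min lexx orbT andbT; lra.
Qed.

Lemma measurable_trunc D f (delta : R) : 0 <= delta -> measurable_fun D f ->
  measurable_fun D (fun x => trunc delta (f x)).
Proof.
move=> d0 mf; under eq_fun do rewrite truncE//.
exact/measurable_maxr/measurable_minr.
Qed.

End bounded_coefficients.

(** * Integrability and square-integrable fields *)

Section real_integrable.
Context (R : realType) (disp : measure_display) (T : measurableType disp).
Context (mu : {measure set T -> \bar R}) (D : set T) (mD : measurable D).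
Implicit Types (f g c : T -> R).

Definition rintegrable f := mu.-integrable D (EFin \o f).

Lemma rintegrableD f g : rintegrable f -> rintegrable g ->
  rintegrable (fun x => f x + g x).
Proof. by move=> intf intg; exact: (integrableD mD intf intg). Qed.

Lemma rintegrableZ (k : R) f : rintegrable f -> rintegrable (fun x => k * f x).
Proof. by move=> intf; exact: (integrableZl mD k intf). Qed.

Lemma rintegrable_sum (I : finType) (F : I -> T -> R) :
  (forall i, rintegrable (F i)) -> rintegrable (fun x => \sum_i F i x).
Proof.
move=> iF; rewrite /rintegrable (_ : _ \o _ = fun x => (\sum_i (F i x)%:E)%E).
  by apply: (integrable_sum mD) => i _; exact: iF.
by apply/funext => x /=; rewrite sumEFin.
Qed.

Lemma rintegrableMl (M : R) c f : measurable_fun D c ->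
  (forall x, D x -> `|c x| <= M) -> rintegrable f ->
  rintegrable (fun x => c x * f x).
Proof.
move=> mc cM intf; have mf : measurable_fun D f.
  by apply/measurable_EFinP; exact: measurable_int intf.
apply: (le_integrable mD _ _ (rintegrableZ M intf)).
  exact/measurable_EFinP/measurable_funM.
move=> x Dx; rewrite lee_fin/= !normrM ler_wpM2r//.
exact: le_trans (cM x Dx) (ler_norm _).
Qed.

(** Lifts the pointwise Young inequalities to integrals. *)
Lemma le_Rintegral_lincomb (a b : R) f g h :
  rintegrable f -> rintegrable g -> rintegrable h ->
  (forall x, D x -> f x <= a * g x + b * h x) ->
  \int[mu]_(x in D) f x <=
    a * \int[mu]_(x in D) g x + b * \int[mu]_(x in D) h x.
Proof.
move=> intf intg inth fgh.
rewrite -!RintegralZl// -RintegralD//; [|exact: rintegrableZ..].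
by apply: le_Rintegral => //; apply: rintegrableD; exact: rintegrableZ.
Qed.

Lemma le_RintegralZ (a : R) f g : rintegrable f -> rintegrable g ->
  (forall x, D x -> f x <= a * g x) ->
  \int[mu]_(x in D) f x <= a * \int[mu]_(x in D) g x.
Proof.
move=> intf intg fg; rewrite -RintegralZl//.
by apply: le_Rintegral => //; exact: rintegrableZ.
Qed.

End real_integrable.

Section L2_fields.
Context (R : realType) (d : nat) (Omega : set 'rV[R]_d).
Context (mOmega : measurable Omega).
Local Notation mu := (@lebesgue_rV R d).
Local Notation L2 := (@L2 R d Omega).
Local Notation rint := (rintegrable mu Omega).
Implicit Types (f g : 'rV[R]_d -> R) (u v w z : 'rV[R]_d -> 'rV[R]_d).
Implicit Types (A B : 'rV[R]_d -> 'M[R]_d).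

(** Domination of |f g| by f^2 + g^2. *)
Lemma L2M f g : L2 f -> L2 g -> rint (fun x => f x * g x).
Proof.
move=> [mf intf] [mg intg].
apply: (le_integrable mOmega _ _ (rintegrableD mOmega intf intg)).
  exact/measurable_EFinP/measurable_funM.
move=> x _; rewrite lee_fin/= normrM [leRHS]ger0_norm ?addr_ge0 ?sqr_ge0//.
rewrite -(real_normK (num_real (f x))) -(real_normK (num_real (g x))).
have := normr_ge0 (f x); have := normr_ge0 (g x); nra.
Qed.

Lemma L2D f g : L2 f -> L2 g -> L2 (fun x => f x + g x).
Proof.
move=> Lf Lg; have [mf _] := Lf; have [mg _] := Lg.
split; first exact: measurable_funD.
rewrite (_ : (fun x => (f x + g x) ^+ 2) = fun x =>
  (f x * f x + 2 * (f x * g x)) + g x * g x); last by apply/funext => x; ring.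
apply: (rintegrableD mOmega _ (L2M Lg Lg)).
apply: (rintegrableD mOmega (L2M Lf Lf)).
exact: (rintegrableZ mOmega _ (L2M Lf Lg)).
Qed.

Lemma L2Z (k : R) f : L2 f -> L2 (fun x => k * f x).
Proof.
move=> [mf intf]; split; first exact: measurable_funM.
rewrite (_ : (fun x => (k * f x) ^+ 2) = fun x => k ^+ 2 * f x ^+ 2).
  exact: (rintegrableZ mOmega).
by apply/funext => x; ring.
Qed.

Lemma L2_zero : L2 (fun=> 0).
Proof.
split; first exact: measurable_cst.
by rewrite expr0n/=; exact: integrable0.
Qed.

Lemma L2_sum (I : finType) (F : I -> 'rV[R]_d -> R) :
  (forall i, L2 (F i)) -> L2 (fun x => \sum_i F i x).
Proof.
move=> LF; elim: (index_enum I) => [|i s ih].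
  by under eq_fun do rewrite big_nil; exact: L2_zero.
by under eq_fun do rewrite big_cons; exact: L2D.
Qed.

Lemma vectorial_L2B u w : vectorial L2 u -> vectorial L2 w ->
  vectorial L2 (u - w).
Proof.
move=> Lu Lw i.
rewrite (_ : component _ _ = fun x => component u i x + (- 1) * component w i x).
  by apply: L2D => //; exact: L2Z.
by apply/funext => x; rewrite /component !mxE mulN1r.
Qed.

Lemma rintegrable_dot u w : vectorial L2 u -> vectorial L2 w ->
  rint (fun x => dot (u x) (w x)).
Proof. by move=> Lu Lw; apply: (rintegrable_sum mOmega) => i; exact: (L2M (Lu i) (Lw i)). Qed.

Definition matrix_L2 A := forall i j, L2 (fun x => A x i j).

Lemma rintegrable_frob A B : matrix_L2 A -> matrix_L2 B ->
  rint (fun x => frob (A x) (B x)).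
Proof.
move=> LA LB; apply: (rintegrable_sum mOmega) => i.
by apply: (rintegrable_sum mOmega) => j; exact: (L2M (LA i j) (LB i j)).
Qed.

Lemma sqr_vL2norm w : vL2norm Omega w ^+ 2 = inner Omega w w.
Proof. by rewrite sqr_sqrtr//; apply: Rintegral_ge0 => x _; exact: dot_ge0. Qed.

Lemma sqr_mL2norm A :
  mL2norm Omega A ^+ 2 = \int[mu]_(x in Omega) frob (A x) (A x).
Proof. by rewrite sqr_sqrtr//; apply: Rintegral_ge0 => x _; exact: frob_ge0. Qed.

Lemma sqr_L2norm f : L2norm Omega f ^+ 2 = \int[mu]_(x in Omega) (f x ^+ 2).
Proof. by rewrite sqr_sqrtr//; apply: Rintegral_ge0 => x _; exact: sqr_ge0. Qed.

Lemma vectorial_H10_L2 w : vectorial (H10 Omega) w -> vectorial L2 w.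
Proof. by move=> Hw i; have [[]] := Hw i. Qed.

Lemma grad_L2 w : vectorial (H10 Omega) w -> matrix_L2 (grad Omega w).
Proof.
move=> Hw i j; under eq_fun do rewrite mxE.
by have [[_ /(_ j)[]]] := Hw i.
Qed.

Lemma div_L2 w : vectorial (H10 Omega) w -> L2 (div Omega w).
Proof. by move=> Hw; apply: L2_sum => i; exact: grad_L2. Qed.

Lemma strain_L2 w : vectorial (H10 Omega) w -> matrix_L2 (strain Omega w).
Proof.
move=> Hw i j; under eq_fun do rewrite mxE [X in _ * X]mxE [X in _ * (_ + X)]mxE.
by apply: L2Z; apply: L2D; exact: grad_L2.
Qed.

Lemma inner_young (s : R) u w : 0 < s -> vectorial L2 u -> vectorial L2 w ->
  2 * inner Omega u w <= s * inner Omega u u + s^-1 * inner Omega w w.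
Proof.
move=> s0 Lu Lw; rewrite -RintegralZl//; last exact: rintegrable_dot.
apply: le_Rintegral_lincomb => //; [|exact: rintegrable_dot..|].
  by apply: rintegrableZ => //; exact: rintegrable_dot.
by move=> x _; exact: dot_young.
Qed.

Lemma inner_polar u w : vectorial L2 u -> vectorial L2 w ->
  2 * inner Omega (u - w) u =
  inner Omega u u - inner Omega w w + inner Omega (u - w) (u - w).
Proof.
move=> Lu Lw; have Luw := vectorial_L2B Lu Lw.
rewrite -RintegralZl//; last exact: rintegrable_dot.
rewrite -RintegralB//; [|exact: rintegrable_dot..].
rewrite -RintegralD//; [| |exact: rintegrable_dot].
  by apply: eq_Rintegral => x _; exact: dot_polar.
exact: (integrableB mOmega (rintegrable_dot Lu Lu) (rintegrable_dot Lw Lw)).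
Qed.

Lemma innerBr u v w : vectorial L2 u -> vectorial L2 v -> vectorial L2 w ->
  inner Omega u (v - w) = inner Omega u v - inner Omega u w.
Proof.
move=> Lu Lv Lw; rewrite -RintegralB//; [|exact: rintegrable_dot..].
by apply: eq_Rintegral => x _; exact: dotBr.
Qed.

Lemma mL2norm_strain_le w : vectorial (H10 Omega) w ->
  mL2norm Omega (strain Omega w) ^+ 2 <= mL2norm Omega (grad Omega w) ^+ 2.
Proof.
move=> Hw; rewrite !sqr_mL2norm; apply: le_Rintegral => //.
- by apply: rintegrable_frob; exact: strain_L2.
- by apply: rintegrable_frob; exact: grad_L2.
- by move=> x _; exact: frob_sym_le.
Qed.

Lemma L2norm_div_le w : vectorial (H10 Omega) w ->
  L2norm Omega (div Omega w) ^+ 2 <= d%:R * mL2norm Omega (grad Omega w) ^+ 2.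
Proof.
move=> Hw; rewrite sqr_L2norm sqr_mL2norm; apply: le_RintegralZ => //.
- by have [] := div_L2 Hw.
- by apply: rintegrable_frob; exact: grad_L2.
- by move=> x _; exact: sqr_mxtrace_le.
Qed.

End L2_fields.

(** * Scaled Young inequality and discrete Gronwall lemma *)

(** Keeps the final coefficients of [Y] and [G] as isolated products, so that a choice of [s] can be
    checked by computing each of them separately. *)
Lemma scale_young_bound (R : realFieldType) (k s c X Y Z G : R) :
  0 <= k -> 0 < s -> 2 * X <= s * Y + s^-1 * Z -> Z <= c * G ->
  k * (2 * X) <= (k * s) * Y + (k * s^-1 * c) * G.
Proof.
move=> k0 s0 XYZ ZG; rewrite -!mulrA -mulrDr ler_wpM2l//.
by apply: (le_trans XYZ); rewrite lerD2l ler_wpM2l// invr_ge0 ltW.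
Qed.

(** Since [x <= 2^-1], the last term of the sum is absorbed on the left, which bounds [V n.+1] by a
    multiple of the previous right-hand side; that side then grows by at most
    [1 + 3 * x <= expR (3 * x)] per step. *)
Lemma discrete_gronwall (R : realType) (c x : R) (V : nat -> R) (N : nat) :
  0 <= x -> x <= 2^-1 -> (forall n, 0 <= V n) ->
  (forall n, (1 <= n <= N)%N ->
     V n <= c + x * \sum_(1 <= i < n.+1) V i) -> 0 <= c ->
  forall n, (n <= N)%N ->
    c + x * \sum_(1 <= i < n.+1) V i <= c * expR (3 * x * n%:R).
Proof.
move=> x0 x2 V0 VN c0; elim=> [|n ih] nN.
  by rewrite big_geq// !mulr0 addr0 expR0 mulr1.
have := VN n.+1; rewrite nN => /(_ isT).
rewrite big_nat_recr//= mulrDr; set S := x * _ in ih *; set W := V n.+1 => WS.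
have {}ih : c + S <= c * expR (3 * x * n%:R) by apply: ih; exact: ltnW.
have cS : 0 <= c + S by rewrite addr_ge0// mulr_ge0// sumr_ge0.
rewrite -[n.+1%:R]natr1 mulrDr mulr1 expRD mulrA.
apply: (@le_trans _ _ ((c + S) * expR (3 * x))); last first.
  by rewrite ler_wpM2r// expR_ge0.
have e3 : 1 + 3 * x <= expR (3 * x) by exact: expR_ge1Dx.
have W0 : 0 <= W by exact: V0.
apply: (@le_trans _ _ ((c + S) * (1 + 3 * x))); last by rewrite ler_wpM2l.
have h1 : (1 - x) * W <= c + S by lra.
have h2 : W <= (c + S) * (1 - x)^-1 by rewrite ler_pdivlMr; lra.
(* The factor 3 chosen here is one of the two factors 3 in the constant 9 of the rate [C2]. *)
have h3 : (1 - x)^-1 <= 3.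
  by rewrite -[leRHS]invrK lef_pV2 ?posrE; lra.
have h4 : W <= (c + S) * 3 by apply: (le_trans h2); rewrite ler_wpM2l.
have := ler_wpM2l x0 h4; lra.
Qed.

(** * Bounds on the truncated coefficients *)

Section coefficients.
Context (R : realType) (d : nat) (E1 E2 l1 l2 delta : R).
Context (E2_lt0 : E2 < 0) (delta_ge0 : 0 <= delta).

Let gamma3 := E1 + d%:R * E2.
Let gamma4 := E1 * l1 + d%:R * E2 * l2.

Context (l1_small : 0 < 1 - `|l1| * delta)
  (gamma4_small : 0 < gamma3 - `|gamma4| * delta)
  (l2_small : 0 < 1 - `|l2| * delta).

Lemma one_plus_bounds (l t : R) : `|t| <= delta ->
  1 - `|l| * delta <= 1 + l * t <= 1 + `|l| * delta.
Proof.
move=> td; have : `|l * t| <= `|l| * delta by rewrite normrM ler_wpM2l.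
by rewrite ler_norml => /andP[? ?]; apply/andP; split; lra.
Qed.

Lemma Fcoef_affine (t : R) : Fcoef d E1 E2 l1 l2 t = gamma3 + gamma4 * t.
Proof. by rewrite /Fcoef ltr0_norm// /gamma3 /gamma4; ring. Qed.

Lemma Fcoef_bounds (t : R) : `|t| <= delta ->
  gamma3 - `|gamma4| * delta <= Fcoef d E1 E2 l1 l2 t
  <= gamma3 + `|gamma4| * delta.
Proof.
move=> td; rewrite Fcoef_affine.
have : `|gamma4 * t| <= `|gamma4| * delta by rewrite normrM ler_wpM2l.
by rewrite ler_norml => /andP[? ?]; apply/andP; split; lra.
Qed.

Definition strain_coef (t : R) : R := (1 + l1 * t)^-1.

(** The weight of the divergence product in the displacement equation, with |E2|/E1 kept apart.
    [strain_coef] is a factor because both elastic terms share a denominator. *)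
Definition div_coef (t : R) : R :=
  (1 + l2 * t) * strain_coef t * (Fcoef d E1 E2 l1 l2 t)^-1.

Lemma strain_coef_bounds (t : R) : `|t| <= delta ->
  (1 + `|l1| * delta)^-1 <= strain_coef t <= (1 - `|l1| * delta)^-1.
Proof.
move=> /(one_plus_bounds l1)/andP[lo up]; have ? := l1_small.
by rewrite /strain_coef !lef_pV2 ?lo ?up ?posrE//; lra.
Qed.

Lemma inv_Fcoef_bounds (t : R) : `|t| <= delta ->
  (gamma3 + `|gamma4| * delta)^-1 <= (Fcoef d E1 E2 l1 l2 t)^-1
  <= (gamma3 - `|gamma4| * delta)^-1.
Proof.
move=> /Fcoef_bounds/andP[lo up]; have ? := gamma4_small.
by rewrite !lef_pV2 ?lo ?up ?posrE//; lra.
Qed.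

Lemma div_coef_bounds (t : R) : `|t| <= delta ->
  (1 - `|l2| * delta) * (1 + `|l1| * delta)^-1 * (gamma3 + `|gamma4| * delta)^-1
  <= div_coef t <=
  (1 + `|l2| * delta) * (1 - `|l1| * delta)^-1 * (gamma3 - `|gamma4| * delta)^-1.
Proof.
move=> td.
have /andP[lo2 up2] := one_plus_bounds l2 td.
have /andP[lo1 up1] := strain_coef_bounds td.
have /andP[loF upF] := inv_Fcoef_bounds td.
have p1 : 0 <= (1 + `|l1| * delta)^-1.
  by rewrite invr_ge0 addr_ge0// mulr_ge0.
have pF : 0 <= (gamma3 + `|gamma4| * delta)^-1.
  by rewrite invr_ge0; have := Fcoef_bounds td => /andP[]; have := gamma4_small; lra.
have p2 : 0 <= 1 - `|l2| * delta by exact: ltW.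
rewrite /div_coef; apply/andP; split; apply: ler_pM => //.
- exact: mulr_ge0.
- exact: ler_pM.
- by apply: mulr_ge0; [exact: le_trans lo2|exact: le_trans lo1].
- exact: le_trans loF.
- apply: ler_pM => //; [exact: le_trans lo2|exact: le_trans lo1].
Qed.

Context (disp : measure_display) (T : measurableType disp) (D : set T) (f : T -> R).
Context (mf : measurable_fun D f).
Let tau x := trunc delta (f x).

Let mtau : measurable_fun D tau.
Proof. exact: measurable_trunc. Qed.

Let tau_le x : `|tau x| <= delta. Proof. exact: norm_trunc_le. Qed.

Lemma measurable_strain_coef : measurable_fun D (fun x => strain_coef (tau x)).
Proof.
apply: measurable_fun_inv_gt0 => [x _|].
  by have := one_plus_bounds l1 (tau_le x) => /andP[]; have := l1_small; lra.
by apply: measurable_funD => //; exact: measurable_funM.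
Qed.

Lemma measurable_div_coef : measurable_fun D (fun x => div_coef (tau x)).
Proof.
apply: measurable_funM.
  apply: measurable_funM; last exact: measurable_strain_coef.
  by apply: measurable_funD => //; exact: measurable_funM.
apply: measurable_fun_inv_gt0 => [x _|].
  by have := Fcoef_bounds (tau_le x) => /andP[]; have := gamma4_small; lra.
under eq_fun do rewrite Fcoef_affine.
by apply: measurable_funD => //; exact: measurable_funM.
Qed.

End coefficients.

(** * Integrals weighted by a bounded coefficient *)

Section elasticity_forms.
Context (R : realType) (d : nat) (Omega : set 'rV[R]_d).
Context (mOmega : measurable Omega).
Local Notation mu := (@lebesgue_rV R d).
Context (c : 'rV[R]_d -> R) (lo up : R) (lo_ge0 : 0 <= lo).
Context (mc : measurable_fun Omega c).
Context (c_bounds : forall x, Omega x -> lo <= c x <= up).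
Implicit Types (f g : 'rV[R]_d -> R) (A B : 'rV[R]_d -> 'M[R]_d).

Let norm_c x : Omega x -> `|c x| <= up.
Proof. by move=> /c_bounds/andP[h1 h2]; rewrite ger0_norm// (le_trans lo_ge0). Qed.

Let rintegrable_c f : rintegrable mu Omega f ->
  rintegrable mu Omega (fun x => c x * f x).
Proof. by move=> intf; exact: (rintegrableMl mOmega mc norm_c). Qed.

Lemma weighted_frob_ge A : matrix_L2 Omega A ->
  lo * mL2norm Omega A ^+ 2 <= \int[mu]_(x in Omega) (c x * frob (A x) (A x)).
Proof.
move=> LA; have intA := rintegrable_frob mOmega LA LA.
rewrite sqr_mL2norm -RintegralZl//; apply: le_Rintegral => //.
- exact: rintegrableZ.
- exact: rintegrable_c.
- by move=> x /c_bounds/andP[h1 h2]; rewrite ler_wpM2r// frob_ge0.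
Qed.

Lemma weighted_sqr_ge f : L2 Omega f ->
  lo * L2norm Omega f ^+ 2 <= \int[mu]_(x in Omega) (c x * (f x * f x)).
Proof.
move=> Lf; have [_ intf] := Lf.
rewrite sqr_L2norm -RintegralZl//; apply: le_Rintegral => //.
- exact: rintegrableZ.
- by apply: rintegrable_c; exact: L2M.
- by move=> x /c_bounds/andP[h1 h2]; rewrite -expr2 ler_wpM2r// sqr_ge0.
Qed.

(** The minus sign is that of the elastic terms once moved to the right-hand side. The bound [up]
    stays with [A], so a test field put in the place of [B] is estimated without it. *)
Lemma weighted_frob_young (s : R) A B : 0 < s ->
  matrix_L2 Omega A -> matrix_L2 Omega B ->
  2 * (- \int[mu]_(x in Omega) (c x * frob (A x) (B x))) <=
  s * up ^+ 2 * mL2norm Omega A ^+ 2 + s^-1 * mL2norm Omega B ^+ 2.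
Proof.
move=> s0 LA LB; rewrite mulrN -mulNr !sqr_mL2norm.
rewrite -(RintegralZl (- 2))//; last by apply: rintegrable_c; exact: rintegrable_frob.
apply: le_Rintegral_lincomb => //; [|exact: rintegrable_frob..|].
  by apply: rintegrableZ => //; apply: rintegrable_c; exact: rintegrable_frob.
move=> x Ox; have := @frob_young _ _ s up (- c x) (A x) (B x) s0.
by rewrite normrN mulNr mulrN -mulNr; apply; exact: norm_c.
Qed.

Lemma weighted_prod_young (s : R) f g : 0 < s -> L2 Omega f -> L2 Omega g ->
  2 * (- \int[mu]_(x in Omega) (c x * (f x * g x))) <=
  s * up ^+ 2 * L2norm Omega f ^+ 2 + s^-1 * L2norm Omega g ^+ 2.
Proof.
move=> s0 Lf Lg; rewrite mulrN -mulNr !sqr_L2norm.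
have [_ intf] := Lf; have [_ intg] := Lg.
rewrite -(RintegralZl (- 2))//; last by apply: rintegrable_c; exact: L2M.
apply: le_Rintegral_lincomb => //.
  by apply: rintegrableZ => //; apply: rintegrable_c; exact: L2M.
move=> x Ox; have := @young_weighted _ s up (- c x) (f x) (g x) s0.
by rewrite normrN mulNr mulrN -mulNr; apply; exact: norm_c.
Qed.

End elasticity_forms.

(** * Energy estimates for one time step *)

(** One energy inequality with weight [ka + kb] pays for [ka] times the jump [x] and [kb] times the
    dissipation [y]; the leftovers [ka * y] and [kb * x] are dropped. This is why D3 is a sum of two
    terms. *)
Lemma weighted_energy_le (R : realDomainType) (ka kb a a' x y z t : R) :
  0 <= ka * y -> 0 <= kb * x ->
  (ka + kb) * (a - a' + x + y) <= (ka + kb) * z ->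
  ka * x + t + kb * y <= (ka + kb) * (a' - a) + (t + (ka + kb) * z).
Proof. lra. Qed.

Section time_step.
Context (R : realType) (d : nat) (Omega : set 'rV[R]_d).
Context (mOmega : measurable Omega).
Local Notation mu := (@lebesgue_rV R d).
Local Notation vH10 := (vectorial (H10 Omega)).
Local Notation L2 := (@L2 R d Omega).
Local Notation eps := (strain Omega).
Local Notation div := (div Omega).
Local Notation inner := (inner Omega).
Local Notation sq w := (vL2norm Omega w ^+ 2).
Local Notation msq A := (mL2norm Omega A ^+ 2).
Local Notation ssq f := (L2norm Omega f ^+ 2).

Context (alpha nu rho dt E1 m : R) (alpha_gt0 : 0 < alpha) (nu_gt0 : 0 < nu).
Context (rho_gt0 : 0 < rho) (dt_gt0 : 0 < dt) (E1_gt0 : 0 < E1) (m_gt0 : 0 < m).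
Context (P K : R) (P_gt0 : 0 < P) (K_gt0 : 0 < K).
Context (poincare : forall w, vH10 w ->
  vL2norm Omega w <= P * mL2norm Omega (grad Omega w)).
Context (korn : forall w, vH10 w ->
  mL2norm Omega (grad Omega w) <= K * mL2norm Omega (eps w)).

Context (g1 g2 g57 g68 : R) (g1_gt0 : 0 < g1) (g2_gt0 : 0 < g2).
Context (g57_gt0 : 0 < g57) (g68_gt0 : 0 < g68).
Context (a b : 'rV[R]_d -> R).
Context (ma : measurable_fun Omega a) (mb : measurable_fun Omega b).
Context (a_bounds : forall x, Omega x -> g1 <= a x <= g2).
Context (b_bounds : forall x, Omega x -> g1 * g57 <= b x <= g2 * g68).

Definition strain_form u z : R :=
  \int[mu]_(x in Omega) (a x * frob (eps u x) (eps z x)).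
Definition div_form u z : R :=
  \int[mu]_(x in Omega) (b x * (div u x * div z x)).

(** This is [d2] of the claim, with [m] for |E2| and [g57] for gamma5 gamma7. *)
Definition dissipation w : R := msq (eps w) + 2 * m * g57 * ssq (div w).

Lemma sqr_poincare w : vH10 w -> sq w <= P ^+ 2 * msq (grad Omega w).
Proof.
by move=> Hw; rewrite -exprMn lerXn2r ?nnegrE ?poincare// ?mulr_ge0 ?sqrtr_ge0// ltW.
Qed.

Lemma sqr_poincare_korn w : vH10 w -> sq w <= (P * K) ^+ 2 * msq (eps w).
Proof.
move=> Hw; apply: (le_trans (sqr_poincare Hw)).
rewrite exprMn -[leRHS]mulrA ler_wpM2l ?sqr_ge0// -exprMn.
by rewrite lerXn2r ?nnegrE ?korn// ?mulr_ge0 ?sqrtr_ge0// ltW.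
Qed.

Lemma dissipation_ge0 w : 0 <= dissipation w.
Proof.
apply: addr_ge0; first exact: sqr_ge0.
by rewrite mulr_ge0 ?sqr_ge0// mulr_ge0 ?mulr_ge0// ltW.
Qed.

(** Test with [u] and multiply by [2 * dt / alpha]. Coercivity yields twice the strain term, and
    half of it absorbs the load; hence the strain enters [dissipation] with coefficient 1 while the
    divergence keeps its factor 2. *)
Lemma displacement_step u' u v : vectorial L2 u' -> vH10 u -> vectorial L2 v ->
  alpha / dt * inner (u - u') u + E1^-1 * strain_form u u + m / E1 * div_form u u
    = alpha * inner v u ->
  sq u - sq u' + sq (u - u') + g1 / (alpha * E1) * (dt * dissipation u)
  <= dt * (alpha * E1 * (P * K) ^+ 2 / g1) * sq v.
Proof.
move=> Lu' Hu Lv eqn; have Lu := vectorial_H10_L2 Hu.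
have polar := inner_polar mOmega Lu Lu'.
have := @weighted_frob_ge _ _ _ mOmega a g1 g2 (ltW g1_gt0) ma a_bounds _
  (strain_L2 mOmega Hu).
rewrite -/(strain_form u u) => J1.
have g157 : 0 <= g1 * g57 by rewrite mulr_ge0// ltW.
have := @weighted_sqr_ge _ _ _ mOmega b (g1 * g57) _ g157 mb b_bounds _
  (div_L2 mOmega Hu).
rewrite -/(div_form u u) => J2.
have PK0 : 0 < P * K by rewrite mulr_gt0.
(* Chosen so that [s^-1 * (P * K) ^+ 2] equals [g1 / (alpha * E1)], half of the strain
   coefficient. *)
pose s := alpha * E1 * (P * K) ^+ 2 / g1.
have s0 : 0 < s by rewrite !mulr_gt0 ?invr_gt0.
have kdt : 0 <= dt by exact: ltW.
have := scale_young_bound kdt s0 (inner_young mOmega s0 Lv Lu)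
  (eq_ind_r (fun t => t <= _) (sqr_poincare_korn Hu) (esym (sqr_vL2norm _ _))).
rewrite -!sqr_vL2norm => Y.
have Yc : dt * s^-1 * (P * K) ^+ 2 = dt * (g1 / (alpha * E1)).
  by rewrite /s; field; rewrite !gt_eqF.
rewrite Yc in Y.
have eqn2 : 2 * inner (u - u') u + 2 * dt / (alpha * E1) * strain_form u u
    + 2 * dt / (alpha * E1) * m * div_form u u = dt * (2 * inner v u).
  transitivity (2 * dt / alpha * (alpha / dt * inner (u - u') u
    + E1^-1 * strain_form u u + m / E1 * div_form u u)).
    by field; rewrite !gt_eqF.
  by rewrite eqn; field; rewrite !gt_eqF.
have k0 : 0 <= 2 * dt / (alpha * E1) by rewrite divr_ge0 ?mulr_ge0// ltW.
have J1' := ler_wpM2l k0 J1.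
have J2' := ler_wpM2l (mulr_ge0 k0 (ltW m_gt0)) J2.
rewrite polar -!sqr_vL2norm in eqn2.
have E : g1 / (alpha * E1) * (dt * dissipation u) =
  2 * dt / (alpha * E1) * (g1 * msq (eps u))
  + 2 * dt / (alpha * E1) * m * (g1 * g57 * ssq (div u))
  - dt * (g1 / (alpha * E1)) * msq (eps u).
  by rewrite /dissipation; field; rewrite !gt_eqF.
rewrite E -/s; set c := 2 * dt / (alpha * E1) in E eqn2 J1' J2' *; lra.
Qed.

Context (C h : R) (C_gt0 : 0 < C) (h_gt0 : 0 < h) (d_le3 : (d <= 3)%N).

(** With [g57] for gamma5 gamma7 and [g68] for gamma6 gamma8, the quotient [m * g68 ^+ 2 / g57] is
    D1, so these are the constants of the claim. *)
Let D2 := 1 + m * g68 ^+ 2 / g57 / 2.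
Let D3 := (alpha * h) ^+ 2 / dt + alpha / E1 * (g2 ^+ 2 / g1) * D2.
Let D4 := (alpha * P) ^+ 2 * (1 + E1 * K ^+ 2 / (alpha * g1) * D3).

(** The coupling (u - u', v) is split along v = (v - w) + w. The first part gains a factor [h] from
    interpolation and gives (alpha h)^2/dt; the second is exchanged, through the displacement
    equation, for [dt] times terms without the jump of [u]. *)
Lemma velocity_step u' u v' v w :
  vectorial L2 u' -> vH10 u -> vectorial L2 v' -> vH10 v -> vH10 w ->
  mL2norm Omega (grad Omega w) <= C * mL2norm Omega (grad Omega v) ->
  vL2norm Omega (v - w) <= C * h * mL2norm Omega (grad Omega v) ->
  alpha / dt * inner (u - u') w + E1^-1 * strain_form u w + m / E1 * div_form u w
    = alpha * inner v w ->
  rho / dt * inner (v - v') v + nu * msq (grad Omega v) + alpha * inner v v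
    = alpha / dt * inner (u - u') v ->
  rho * (sq v - sq v') + 2 * alpha * dt * sq v <=
  3 * C ^+ 2 / nu * ((alpha * h) ^+ 2 / dt * sq (u - u')
    + (alpha * P) ^+ 2 * dt * sq v
    + (g2 ^+ 2 * D2 / E1 ^+ 2) * (dt * dissipation u)).
Proof.
move=> Lu' Hu Lv' Hv Hw gradw vw eqw eqv.
have Lu := vectorial_H10_L2 Hu; have Lv := vectorial_H10_L2 Hv.
have Lw := vectorial_H10_L2 Hw; have Luu := vectorial_L2B mOmega Lu Lu'.
have polar := inner_polar mOmega Lv Lv'.
have split_v := innerBr mOmega Luu Lv Lw.
set G := msq (grad Omega v) in eqv *.
have gradw2 : msq (grad Omega w) <= C ^+ 2 * G.
  by rewrite -exprMn lerXn2r ?nnegrE// ?mulr_ge0 ?sqrtr_ge0// ltW.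
have vw2 : sq (v - w) <= (C * h) ^+ 2 * G.
  by rewrite -exprMn lerXn2r ?nnegrE// ?mulr_ge0 ?sqrtr_ge0 ?mulr_ge0// ltW.
have w2 : sq w <= P ^+ 2 * C ^+ 2 * G.
  apply: (le_trans (sqr_poincare Hw)).
  by rewrite -[leRHS]mulrA ler_wpM2l ?sqr_ge0.
have ew2 : msq (eps w) <= C ^+ 2 * G.
  exact: le_trans (mL2norm_strain_le mOmega Hw) gradw2.
have qw2 : ssq (div w) <= 3 * C ^+ 2 * G.
  apply: (le_trans (L2norm_div_le mOmega Hw)); rewrite -[leRHS]mulrA.
  by apply: ler_pM; [exact: ler0n|exact: sqr_ge0|rewrite ler_nat|exact: gradw2].
have D2_gt0 : 0 < D2.
  by apply: addr_gt0 => //; do 2!apply: divr_gt0 => //; rewrite mulr_gt0// exprn_gt0.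
have g268 : 0 <= g2 * g68 by rewrite mulr_ge0// ltW.
(* Of the budget 2 nu dt |grad v|^2, the terms weighted by sa and sb take
   (nu dt / 3) |grad v|^2 each, and those weighted by s1 and s2 together at
   most nu dt |grad v|^2. *)
pose sa := 3 * alpha * (C * h) ^+ 2 / (nu * dt).
have sa0 : 0 < sa by rewrite !mulr_gt0 ?invr_gt0 ?mulr_gt0.
pose sb := 3 * alpha * P ^+ 2 * C ^+ 2 / nu.
have sb0 : 0 < sb by rewrite !mulr_gt0 ?invr_gt0.
pose s1 := 3 * C ^+ 2 * D2 / (nu * E1).
have s10 : 0 < s1 by rewrite !mulr_gt0 ?invr_gt0 ?mulr_gt0.
pose s2 := 3 * C ^+ 2 * D2 * 2 * g57 / (nu * E1 * g68 ^+ 2).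
have s20 : 0 < s2 by rewrite !mulr_gt0 ?invr_gt0 ?mulr_gt0.
have Lvw := vectorial_L2B mOmega Lv Lw.
have ineq_a := inner_young mOmega sa0 Luu Lvw.
rewrite -!sqr_vL2norm in ineq_a.
have {ineq_a}Ya := scale_young_bound (ltW alpha_gt0) sa0 ineq_a vw2.
have ineq_b := inner_young mOmega sb0 Lv Lw.
rewrite -!sqr_vL2norm in ineq_b.
have {ineq_b}Yb := scale_young_bound (ltW (mulr_gt0 dt_gt0 alpha_gt0)) sb0 ineq_b w2.
have ineq_1 := @weighted_frob_young _ _ _ mOmega a g1 g2 (ltW g1_gt0) ma a_bounds
  s1 _ _ s10 (strain_L2 mOmega Hu) (strain_L2 mOmega Hw).
rewrite -/(strain_form u w) -mulrA in ineq_1.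
have {ineq_1}Y1 := scale_young_bound (ltW (divr_gt0 dt_gt0 E1_gt0)) s10 ineq_1 ew2.
have g157 : 0 <= g1 * g57 by rewrite mulr_ge0// ltW.
have ineq_2 := @weighted_prod_young _ _ _ mOmega b (g1 * g57) _ g157 mb b_bounds
  s2 _ _ s20 (div_L2 mOmega Hu) (div_L2 mOmega Hw).
rewrite -/(div_form u w) -mulrA in ineq_2.
have {ineq_2}Y2 := scale_young_bound
  (ltW (mulr_gt0 (divr_gt0 dt_gt0 E1_gt0) m_gt0)) s20 ineq_2 qw2.
have nz : (alpha != 0) * (nu != 0) * (dt != 0) * (C != 0) * (h != 0) * (P != 0)
  * (E1 != 0) * (D2 != 0) * (g57 != 0) * (g68 != 0) * (m != 0).
  by rewrite !gt_eqF.
have Ea : alpha * sa^-1 * (C * h) ^+ 2 = nu * dt / 3.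
  by rewrite /sa; field; rewrite !nz.
have Eb : dt * alpha * sb^-1 * (P ^+ 2 * C ^+ 2) = nu * dt / 3.
  by rewrite /sb; field; rewrite !nz.
have Ec : dt / E1 * s1^-1 * C ^+ 2 = nu * dt * (3^-1 / D2).
  by rewrite /s1; field; rewrite !nz.
have Ed : dt / E1 * m * s2^-1 * (3 * C ^+ 2) = nu * dt * ((D2 - 1) / D2).
  rewrite (_ : D2 - 1 = m * g68 ^+ 2 / g57 / 2); last by rewrite /D2; ring.
  by rewrite /s2; field; rewrite !nz.
rewrite Ea in Ya; rewrite Eb in Yb; rewrite Ec in Y1; rewrite Ed in Y2.
(* The strain takes the share 1/(3 D2), the divergence (D2 - 1)/D2: the 3 in [s2] cancels the
   dimension factor of [qw2], while the 3 in [s1] is a gain. *)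
have share : 3^-1 / D2 + (D2 - 1) / D2 <= 1.
  rewrite -mulrDl ler_pdivrMr// mul1r addrCA gerDl subr_le0.
  by rewrite invf_le1 ?ler1n// ltr0n.
have G0 : 0 <= nu * dt * G by rewrite mulr_ge0 ?sqr_ge0// mulr_ge0// ltW.
have shareG := ler_wpM2l G0 share.
have Fa : alpha * sa = 3 * C ^+ 2 / nu * ((alpha * h) ^+ 2 / dt).
  by rewrite /sa; field; rewrite !nz.
have Fb : dt * alpha * sb = 3 * C ^+ 2 / nu * ((alpha * P) ^+ 2 * dt).
  by rewrite /sb; field; rewrite !nz.
(* [s1] and [s2] are tuned so that the strain and divergence of [u] carry one common factor and add
   up to [dissipation u]. *)
have F1 : dt / E1 * s1 * (g2 ^+ 2 * msq (eps u))
  = 3 * C ^+ 2 / nu * ((g2 ^+ 2 * D2 / E1 ^+ 2) * (dt * msq (eps u))).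
  by rewrite /s1; field; rewrite !nz.
have F2 : dt / E1 * m * s2 * ((g2 * g68) ^+ 2 * ssq (div u))
  = 3 * C ^+ 2 / nu * ((g2 ^+ 2 * D2 / E1 ^+ 2)
    * (dt * (2 * m * g57 * ssq (div u)))).
  by rewrite /s2; field; rewrite !nz.
rewrite Fa in Ya; rewrite Fb in Yb; rewrite F1 in Y1; rewrite F2 in Y2.
rewrite -sqr_vL2norm in eqv.
have eqv2 : rho * (2 * inner (v - v') v) + 2 * (nu * dt * G) + 2 * alpha * dt * sq v
    = 2 * alpha * inner (u - u') v.
  transitivity (2 * dt * (rho / dt * inner (v - v') v + nu * G + alpha * sq v)).
    by field; rewrite !nz.
  by rewrite eqv; field; rewrite !nz.
have eqw2 : 2 * alpha * inner (u - u') w = dt * alpha * (2 * inner v w)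
    + dt / E1 * (2 * - strain_form u w) + dt / E1 * m * (2 * - div_form u w).
  transitivity (2 * dt * (alpha * inner v w - E1^-1 * strain_form u w
    - m / E1 * div_form u w)); last by field; rewrite !nz.
  by rewrite -eqw; field; rewrite !nz.
have W0 : 0 <= rho * sq (v - v') by rewrite mulr_ge0 ?sqr_ge0// ltW.
rewrite polar -!sqr_vL2norm in eqv2.
rewrite /dissipation.
move: (strain_form u w) (div_form u w) eqw2 Y1 Y2 => J1 J2 eqw2 Y1 Y2.
rewrite split_v in Ya.
clear eqw eqv share nz Ea Eb Ec Ed Fa Fb F1 F2 sa0 sb0 s10 s20 gradw vw gradw2
  vw2 w2 ew2 qw2 split_v polar g268 D2_gt0 g157.
lra.
Qed.

(** Adding [D3] times the displacement estimate removes the jump and the dissipation of [u] in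
    favour of a telescoping difference. Its load term, added to (alpha P)^2 dt |v|^2, makes up
    [D4]. *)
Lemma coupled_step u' u v' v w :
  vectorial L2 u' -> vH10 u -> vectorial L2 v' -> vH10 v -> vH10 w ->
  mL2norm Omega (grad Omega w) <= C * mL2norm Omega (grad Omega v) ->
  vL2norm Omega (v - w) <= C * h * mL2norm Omega (grad Omega v) ->
  (forall z, z = u \/ z = w -> alpha / dt * inner (u - u') z
    + E1^-1 * strain_form u z + m / E1 * div_form u z = alpha * inner v z) ->
  rho / dt * inner (v - v') v + nu * msq (grad Omega v) + alpha * inner v v
    = alpha / dt * inner (u - u') v ->
  rho * (sq v - sq v') + 2 * alpha * dt * sq v <=
  3 * C ^+ 2 / nu * (D3 * (sq u' - sq u) + D4 * dt * sq v).
Proof.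
move=> Lu' Hu Lv' Hv Hw gradw vw eqn eqv.
apply: (le_trans (velocity_step Lu' Hu Lv' Hv Hw gradw vw (eqn _ (or_intror erefl)) eqv)).
have en := displacement_step Lu' Hu (vectorial_H10_L2 Hv) (eqn _ (or_introl erefl)).
have D2_gt0 : 0 < D2.
  by apply: addr_gt0 => //; do 2!apply: divr_gt0 => //; rewrite mulr_gt0// exprn_gt0.
have k0 : 0 <= (alpha * h) ^+ 2 / dt by rewrite divr_ge0 ?sqr_ge0// ltW.
have k1 : 0 <= alpha / E1 * (g2 ^+ 2 / g1) * D2.
  by rewrite !mulr_ge0 ?invr_ge0 ?sqr_ge0// ltW.
have D30 : 0 <= D3 by rewrite addr_ge0.
have Y0 : 0 <= g1 / (alpha * E1) * (dt * dissipation u).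
  by rewrite mulr_ge0 ?divr_ge0 ?mulr_ge0 ?dissipation_ge0// ltW.
have X0 : 0 <= sq (u - u') by exact: sqr_ge0.
have c0 : 0 <= 3 * C ^+ 2 / nu by rewrite !mulr_ge0 ?invr_ge0 ?sqr_ge0// ltW.
rewrite ler_wpM2l//.
have en' := ler_wpM2l D30 en.
have E4 : D4 * dt * sq v = (alpha * P) ^+ 2 * dt * sq v
    + D3 * (dt * (alpha * E1 * (P * K) ^+ 2 / g1) * sq v).
  by rewrite /D4; field; rewrite !gt_eqF.
have Ed : g2 ^+ 2 * D2 / E1 ^+ 2 * (dt * dissipation u)
    = alpha / E1 * (g2 ^+ 2 / g1) * D2 * (g1 / (alpha * E1) * (dt * dissipation u)).
  by field; rewrite !gt_eqF.
rewrite E4 Ed.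
have kY := mulr_ge0 k0 Y0; have kX := mulr_ge0 k1 X0.
exact: weighted_energy_le kY kX en'.
Qed.

End time_step.

(** * Summation over the time steps *)

(** [A] and [V] stand for the squared norms of displacement and velocity, [X] for the dissipated
    quantities. Both step inequalities telescope; the sum of the [V i] in the first is bounded
    through Gronwall applied to the second. *)
Lemma summed_estimate (R : realType) (alpha rho dt c k D3 D4 : R)
    (A V X : nat -> R) (N : nat) :
  0 < alpha -> 0 < rho -> 0 < dt -> 0 <= c -> 0 <= k -> 0 <= D3 -> 0 <= D4 ->
  (forall n, 0 <= A n) -> (forall n, 0 <= V n) ->
  2 * (k * D4 / rho) * dt <= 1 ->
  (forall n, (1 <= n <= N)%N -> A n - A n.-1 + X n <= dt * c * V n) ->
  (forall n, (1 <= n <= N)%N -> rho * (V n - V n.-1) + 2 * alpha * dt * V n <=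
     k * (D3 * (A n.-1 - A n) + D4 * dt * V n)) ->
  forall n, (n <= N)%N ->
  A n + \sum_(1 <= i < n.+1) X i <= A 0%N + c * (rho / (2 * alpha)) *
    (V 0%N + k * D3 / rho * A 0%N) * expR (3 * (k * D4 / rho) * (n%:R * dt)).
Proof.
move=> alpha0 rho0 dt0 c0 k0 D30 D40 A0 V0 small stepA stepV.
pose S n := \sum_(1 <= i < n.+1) V i.
have SS n : S n.+1 = S n + V n.+1 by rewrite /S big_nat_recr.
have S0 : S 0%N = 0 by rewrite /S big_geq.
have sumA n : (n <= N)%N -> A n + \sum_(1 <= i < n.+1) X i <= A 0%N + dt * c * S n.
  elim: n => [|n ih] nN; first by rewrite S0 big_geq// mulr0.
  rewrite SS big_nat_recr//=; have := ih (ltnW nN).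
  by have := stepA n.+1; rewrite nN => /(_ isT)/=; lra.
have sumV n : (n <= N)%N -> rho * V n + k * D3 * A n + 2 * alpha * dt * S n <=
    rho * V 0%N + k * D3 * A 0%N + k * D4 * dt * S n.
  elim: n => [|n ih] nN; first by rewrite S0 !mulr0 !addr0.
  rewrite SS; have := ih (ltnW nN).
  by have := stepV n.+1; rewrite nN => /(_ isT)/=; lra.
pose C1 := V 0%N + k * D3 / rho * A 0%N.
pose x := k * D4 / rho * dt.
have kr : 0 <= k * D4 / rho by rewrite divr_ge0 ?mulr_ge0// ltW.
have x0 : 0 <= x by rewrite mulr_ge0// ltW.
have x2 : x <= 2^-1.
  by rewrite -[leRHS]mul1r ler_pdivlMr// mulrC /x mulrA.
have C10 : 0 <= C1 by rewrite addr_ge0 ?mulr_ge0 ?invr_ge0// ltW.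
have C1E : C1 = (rho * V 0%N + k * D3 * A 0%N) / rho.
  by rewrite /C1; field; rewrite gt_eqF.
have Sge0 n : 0 <= S n by exact: sumr_ge0.
have sumV' n : (n <= N)%N ->
    V n + 2 * alpha / rho * (dt * S n) <= C1 + x * S n.
  move=> /sumV h.
  rewrite (_ : C1 + x * S n =
    (rho * V 0%N + k * D3 * A 0%N + k * D4 * dt * S n) / rho); last first.
    by rewrite C1E /x; field; rewrite gt_eqF.
  rewrite ler_pdivlMr//; apply: le_trans h.
  rewrite (_ : _ * rho = rho * V n + 2 * alpha * dt * S n); last first.
    by field; rewrite gt_eqF.
  by rewrite lerD2r lerDl !mulr_ge0.
have sum_ge0 n : 0 <= 2 * alpha / rho * (dt * S n).
  by rewrite !mulr_ge0 ?invr_ge0// ltW.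
have G := @discrete_gronwall _ C1 x V N x0 x2 V0 _ C10.
move=> n nN; apply: (le_trans (sumA _ nN)); rewrite lerD2l.
(* [sumV'] is used twice: here its damping sum is dropped to feed Gronwall, and below [V n] is
   dropped to bound that sum. *)
have : C1 + x * S n <= C1 * expR (3 * x * n%:R).
  apply: G => // i /andP[_ iN]; have := sumV' _ iN.
  by have := sum_ge0 i; rewrite -/(S i); lra.
rewrite (_ : 3 * x * n%:R = 3 * (k * D4 / rho) * (n%:R * dt)); last by rewrite /x; ring.
set e := expR _ => Ge.
have le : 2 * alpha / rho * (dt * S n) <= C1 * e.
  by have := sumV' _ nN; have := V0 n; lra.
have cr : 0 <= c * (rho / (2 * alpha)) by rewrite !mulr_ge0 ?invr_ge0 ?mulr_ge0// ltW.
have -> : dt * c * S n = c * (rho / (2 * alpha)) * (2 * alpha / rho * (dt * S n)).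
  by field; rewrite !gt_eqF.
by rewrite -[leRHS]mulrA ler_wpM2l.
Qed.

(** * Application to the fully discrete scheme *)

Theorem corollary1 (R : realType) (d : nat) (hd : d = 2%N \/ d = 3%N)
  (* domain and final time *)
  (Omega : set 'rV[R]_d) (Omega_nonempty : Omega !=set0)
  (Omega_open : open Omega) (Omega_bounded : bounded_set Omega)
  (Omega_connected : connected Omega) (Omega_lipschitz : lipschitz_domain Omega)
  (Omega_polytopal : polytopal Omega)
  (T : R) (T_gt0 : 0 < T)
  (* material parameters *)
  (alpha nu rho : R) (alpha_gt0 : 0 < alpha) (nu_gt0 : 0 < nu) (rho_gt0 : 0 < rho)
  (E1 E2 : R) (E1_gt0 : 0 < E1) (E2_lt0 : E2 < 0)
  (E1E2 : 0 < E1 - d%:R * `|E2|)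
  (* initial data *)
  (u0 v0 : 'rV[R]_d -> 'rV[R]_d) (u0_H10 : vectorial (H10 Omega) u0)
  (v0_V : divfree Omega v0)
  (* standing assumption on the continuous problem *)
  (lbar D : R) (lbar_gt0 : 0 < lbar) (D_gt0 : 0 < D)
  (continuous_solvable : solvable Omega T alpha nu rho E1 E2 u0 v0 lbar D)
  (* truncation level *)
  (delta : R) (D_le_delta : D <= delta)
  (* Poincare and Korn constants *)
  (P K : R) (P_gt0 : 0 < P) (K_gt0 : 0 < K)
  (poincare : forall w, vectorial (H10 Omega) w ->
     vL2norm Omega w <= P * mL2norm Omega (grad Omega w))
  (korn : forall w, vectorial (H10 Omega) w ->
     mL2norm Omega (grad Omega w) <= K * mL2norm Omega (strain Omega w))
  (* family of discretizations indexed by the mesh size *)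
  (mesh_sizes : set R) (mesh_sizes_gt0 : forall h, mesh_sizes h -> 0 < h)
  (Uh Xh : R -> set ('rV[R]_d -> 'rV[R]_d)) (Qh : R -> set ('rV[R]_d -> R))
  (Uh_fe : forall h, mesh_sizes h ->
     fe_space Omega (vectorial (@smooth R d)) h (Uh h))
  (Xh_fe : forall h, mesh_sizes h ->
     fe_space Omega (vectorial (@smooth R d)) h (Xh h))
  (Qh_fe : forall h, mesh_sizes h ->
     @fe_space R d Omega R^o (@smooth R d) h (Qh h))
  (Uh_sub : forall h, mesh_sizes h -> Uh h `<=` vectorial (H10 Omega))
  (Xh_sub : forall h, mesh_sizes h -> Xh h `<=` vectorial (H10 Omega))
  (Qh_sub : forall h, mesh_sizes h -> Qh h `<=` L20 Omega)
  (beta : R) (beta_gt0 : 0 < beta)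
  (inf_sup : forall h, mesh_sizes h -> infsup Omega (Xh h) (Qh h) = beta)
  (C : R) (C_gt0 : 0 < C)
  (PiU PiX PiV : R -> ('rV[R]_d -> 'rV[R]_d) -> ('rV[R]_d -> 'rV[R]_d))
  (PiU_interp : forall h, mesh_sizes h ->
     interpolation Omega (vectorial (H10 Omega)) (Uh h) C h (PiU h))
  (PiX_interp : forall h, mesh_sizes h ->
     interpolation Omega (vectorial (H10 Omega)) (Xh h) C h (PiX h))
  (PiV_interp : forall h, mesh_sizes h ->
     interpolation Omega (divfree Omega) (discrete_divfree Omega (Xh h) (Qh h))
       C h (PiV h))
  (* the discretization under consideration *)
  (h : R) (h_mesh : mesh_sizes h) (N : nat) (N_gt1 : (1 < N)%N)
  (l1 l2 : R) (l1_small : `|l1| <= lbar) (l2_small : `|l2| <= lbar)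
  (u v : nat -> 'rV[R]_d -> 'rV[R]_d) (p : nat -> 'rV[R]_d -> R) :
  let dt := T / N%:R in
  let gamma1 := (1 + `|l1| * delta)^-1 in
  let gamma2 := (1 - `|l1| * delta)^-1 in
  let gamma3 := E1 + d%:R * E2 in
  let gamma4 := E1 * l1 + d%:R * E2 * l2 in
  let gamma5 := (gamma3 + `|gamma4| * delta)^-1 in
  let gamma6 := (gamma3 - `|gamma4| * delta)^-1 in
  let gamma7 := 1 - `|l2| * delta in
  let gamma8 := 1 + `|l2| * delta in
  let D1 := (gamma6 * gamma8) ^+ 2 / (gamma5 * gamma7) * `|E2| in
  let D2 := 1 + D1 / 2 in
  let D3 := (alpha * h) ^+ 2 / dt + alpha / E1 * (gamma2 ^+ 2 / gamma1) * D2 in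
  let D4 := (alpha * P) ^+ 2 * (1 + E1 * K ^+ 2 / (alpha * gamma1) * D3) in
  let d2 f := mL2norm Omega (strain Omega f) ^+ 2
              + 2 * `|E2| * gamma5 * gamma7 * L2norm Omega (div Omega f) ^+ 2 in
  let C1 := vL2norm Omega (v 0%N) ^+ 2
            + 3 * C ^+ 2 * D3 / (nu * rho) * vL2norm Omega (u 0%N) ^+ 2 in
  let C2 := 9 * C ^+ 2 * D4 / (nu * rho) in
  (* smallness of the coefficients and of the time step *)
  0 < 1 - `|l1| * delta -> 0 < gamma3 - `|gamma4| * delta ->
  0 < 1 - `|l2| * delta ->
  6 * C ^+ 2 * D4 / (nu * rho) * dt <= 1 ->
  (* the fully discrete scheme *)
  u 0%N = PiU h u0 -> v 0%N = PiV h v0 ->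
  (forall n, (1 <= n <= N)%N ->
     scheme_step Omega alpha nu rho E1 E2 l1 l2 delta dt (Uh h) (Xh h) (Qh h)
       (u n.-1) (v n.-1) (u n) (v n) (p n)) ->
  forall n, (1 <= n <= N)%N ->
    vL2norm Omega (u n) ^+ 2
    + \sum_(1 <= i < n.+1) vL2norm Omega (u i - u i.-1) ^+ 2
    + gamma1 / (alpha * E1) * \sum_(1 <= i < n.+1) dt * d2 (u i)
    <= vL2norm Omega (u 0%N) ^+ 2
       + E1 / gamma1 * ((P * K) ^+ 2 / 2) * rho * C1 * expR (C2 * (n%:R * dt)).
Proof.
move=> dt gamma1 gamma2 gamma3 gamma4 gamma5 gamma6 gamma7 gamma8 D1 D2 D3 D4.
move=> d2 C1 C2 small1 small34 small2 dt_small u_init v_init step.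
have mOmega := open_measurable_rV Omega_open.
have h0 : 0 < h by exact: mesh_sizes_gt0.
have delta0 : 0 <= delta by exact: le_trans (ltW D_gt0) D_le_delta.
have m0 : 0 < `|E2| by rewrite normr_gt0 lt_eqF.
have dt0 : 0 < dt by rewrite divr_gt0// ltr0n (ltn_trans _ N_gt1).
have g10 : 0 < gamma1 by rewrite invr_gt0 ltr_wpDr ?mulr_ge0.
have g20 : 0 < gamma2 by rewrite invr_gt0.
have g50 : 0 < gamma5.
  rewrite invr_gt0; apply: (lt_le_trans small34); rewrite lerD2l.
  by rewrite (@le_trans _ _ 0) ?oppr_le0 ?mulr_ge0.
have g60 : 0 < gamma6 by rewrite invr_gt0.
have g80 : 0 < gamma8 by rewrite ltr_wpDr ?mulr_ge0.
have g570 : 0 < gamma5 * gamma7 by rewrite mulr_gt0.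
have g680 : 0 < gamma6 * gamma8 by rewrite mulr_gt0.
have u_Uh i : (i <= N)%N -> Uh h (u i).
  case: i => [_|i iN]; first by rewrite u_init; have [] := PiU_interp h h_mesh u0 u0_H10.
  by have [] := step i.+1 iN.
have v_Vh i : (i <= N)%N -> discrete_divfree Omega (Xh h) (Qh h) (v i).
  case: i => [_|i iN]; first by rewrite v_init; have [] := PiV_interp h h_mesh v0 v0_V.
  by have [] := step i.+1 iN.
have Hu i : (i <= N)%N -> vectorial (H10 Omega) (u i).
  by move=> /u_Uh; exact: Uh_sub.
have Hv i : (i <= N)%N -> vectorial (H10 Omega) (v i).
  by move=> /v_Vh[+ _]; exact: Xh_sub.
(* The coefficients of step [i] are frozen at [i.-1]. The value at [i = 0] is a dummy, since the
   steps start at 1. *)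
pose a i x := strain_coef l1 (trunc delta (div Omega (u i.-1) x)).
pose b i x := div_coef d E1 E2 l1 l2 (trunc delta (div Omega (u i.-1) x)).
have ma i : (i <= N)%N -> measurable_fun Omega (a i).
  move=> iN; apply: measurable_strain_coef => //.
  by have [] := div_L2 mOmega (Hu i.-1 (leq_trans (leq_pred _) iN)).
have mb i : (i <= N)%N -> measurable_fun Omega (b i).
  move=> iN; apply: measurable_div_coef => //.
  by have [] := div_L2 mOmega (Hu i.-1 (leq_trans (leq_pred _) iN)).
have a_bounds i x : Omega x -> gamma1 <= a i x <= gamma2.
  by move=> _; apply: strain_coef_bounds => //; exact: norm_trunc_le.
have b_bounds i x : Omega x ->
    gamma1 * (gamma5 * gamma7) <= b i x <= gamma2 * (gamma6 * gamma8).
  move=> _; rewrite (mulrC gamma5) (mulrC gamma6) !mulrA.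
  rewrite (mulrC gamma1) (mulrC gamma2).
  by apply: div_coef_bounds => //; exact: norm_trunc_le.
have eq_u i : (1 <= i <= N)%N -> forall z, Uh h z ->
    alpha / dt * inner Omega (u i - u i.-1) z
    + E1^-1 * strain_form Omega (a i) (u i) z
    + `|E2| / E1 * div_form Omega (b i) (u i) z = alpha * inner Omega (v i) z.
  move=> /step[_ _ _ eqn _] z /eqn <-; congr (_ + _ * _ + _ * _).
    by apply: eq_Rintegral => x _; rewrite mulrC.
  by apply: eq_Rintegral => x _; rewrite /b /div_coef /strain_coef; ring.
have eq_v i : (1 <= i <= N)%N ->
    rho / dt * inner Omega (v i - v i.-1) (v i)
    + nu * mL2norm Omega (grad Omega (v i)) ^+ 2
    + alpha * inner Omega (v i) (v i)
    = alpha / dt * inner Omega (u i - u i.-1) (v i).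
  (* Testing with [v i] itself removes the pressure, because [v i] is discretely divergence free. *)
  move=> iN; have [_ [vX vdiv] pQ _ /(_ _ vX)] := step i iN.
  by rewrite vdiv// subr0 sqr_mL2norm.
have D2E : D2 = 1 + `|E2| * (gamma6 * gamma8) ^+ 2 / (gamma5 * gamma7) / 2.
  by rewrite /D2 /D1; congr (1 + _ / 2); ring.
have D10 : 0 <= D1 by apply: mulr_ge0 => //; apply: divr_ge0; [exact: sqr_ge0|exact: ltW].
have D20 : 0 <= D2 by apply: addr_ge0 => //; exact: divr_ge0.
have D30 : 0 <= D3.
  apply: addr_ge0; first by apply: divr_ge0; [exact: sqr_ge0|exact: ltW].
  apply: mulr_ge0 => //; apply: mulr_ge0; first by rewrite divr_ge0// ltW.
  by apply: divr_ge0; [exact: sqr_ge0|exact: ltW].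
have D40 : 0 <= D4.
  apply: mulr_ge0; first exact: sqr_ge0.
  apply: addr_ge0 => //; apply: mulr_ge0 => //; apply: divr_ge0.
    by apply: mulr_ge0; [exact: ltW|exact: sqr_ge0].
  by rewrite ltW// mulr_gt0.
have d_le3 : (d <= 3)%N by case: hd => ->.
pose A i := vL2norm Omega (u i) ^+ 2.
pose V i := vL2norm Omega (v i) ^+ 2.
pose X i := vL2norm Omega (u i - u i.-1) ^+ 2 + gamma1 / (alpha * E1) * (dt * d2 (u i)).
have stepA i : (1 <= i <= N)%N ->
    A i - A i.-1 + X i <= dt * (alpha * E1 * (P * K) ^+ 2 / gamma1) * V i.
  move=> iN; have /andP[_ iN'] := iN.
  have := displacement_step mOmega alpha_gt0 dt0 E1_gt0 m0 P_gt0 K_gt0 poincare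
    korn g10 g570 (ma _ iN') (mb _ iN') (a_bounds i) (b_bounds i)
    (vectorial_H10_L2 (Hu _ (leq_trans (leq_pred _) iN')))
    (Hu _ iN') (vectorial_H10_L2 (Hv _ iN')) (eq_u _ iN _ (u_Uh _ iN')).
  by rewrite /X addrA /d2 /dissipation !mulrA.
have stepV i : (1 <= i <= N)%N ->
    rho * (V i - V i.-1) + 2 * alpha * dt * V i <=
    3 * C ^+ 2 / nu * (D3 * (A i.-1 - A i) + D4 * dt * V i).
  move=> iN; have /andP[_ iN'] := iN.
  have iN1 := leq_trans (leq_pred _) iN'.
  (* The velocity is interpolated into the displacement space, where it is admissible in the
     displacement equation. *)
  have [wU gradw vw] := PiU_interp h h_mesh (v i) (Hv _ iN').
  have := coupled_step mOmega alpha_gt0 nu_gt0 rho_gt0 dt0 E1_gt0 m0 P_gt0 K_gt0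
    poincare korn g10 g20 g570 g680 (ma _ iN') (mb _ iN') (a_bounds i) (b_bounds i)
    C_gt0 h0 d_le3 (vectorial_H10_L2 (Hu _ iN1)) (Hu _ iN')
    (vectorial_H10_L2 (Hv _ iN1)) (Hv _ iN') (Uh_sub h h_mesh _ wU) gradw vw _ (eq_v _ iN).
  rewrite /= -D2E -/D3 -/D4.
  by apply => z Hz; apply: (eq_u _ iN); case: Hz => -> //; exact: u_Uh.
move=> n /andP[_ nN].
have k0 : 0 <= 3 * C ^+ 2 / nu by rewrite !mulr_ge0 ?invr_ge0 ?sqr_ge0// ltW.
have c0 : 0 <= alpha * E1 * (P * K) ^+ 2 / gamma1.
  apply: divr_ge0; last exact: ltW.
  by apply: mulr_ge0; [rewrite mulr_ge0// ltW|exact: sqr_ge0].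
have := @summed_estimate R alpha rho dt _ _ D3 D4 A V X N alpha_gt0 rho_gt0 dt0
  c0 k0 D30 D40 (fun=> sqr_ge0 _) (fun=> sqr_ge0 _) _ stepA stepV n nN.
have nz : (alpha != 0) * (nu != 0) * (rho != 0) * (gamma1 != 0) by rewrite !gt_eqF.
(* With [k] equal to 3 C^2/nu, the time step condition is exactly the smallness required for
   Gronwall. *)
rewrite (_ : 2 * _ * dt = 6 * C ^+ 2 * D4 / (nu * rho) * dt); last first.
  by field; rewrite !nz.
move=> /(_ dt_small); rewrite big_split/= -mulr_sumr addrA => /le_trans; apply.
rewrite (_ : 3 * (3 * C ^+ 2 / nu * D4 / rho) = C2); last by rewrite /C2; field; rewrite !nz.
rewrite lerD2l le_eqVlt; apply/orP; left; apply/eqP; congr (_ * _).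
by rewrite /C1 -/(V 0%N) -/(A 0%N); field; rewrite !nz.
Qed.
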